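(* Assume (EDR) with $\beta>1$, embedding index $\alpha_0$ with $\frac1\beta\le\alpha_0<1$, (Source) with $0<s\le2\tau$, and (Noise). Let $(x_i,y_i)_{i=1}^n$ be i.i.d. from $\rho$. (i) If $s+\frac1\beta>\alpha_0$, choose $\nu\asymp n^{\frac{\beta}{s\beta+1}}$. Then for any fixed $\delta\in(0,1)$, for $n$ sufficiently large, with probability at least $1-\delta$, $$\big\|T_\nu^{-1/2}\big[(g_Z-T_Xf_\nu)-(g-Tf_\nu)\big]\big\|_{\mathcal H}\le\ln\frac2\delta\,C\frac{\nu^{\frac1{2\beta}}}{\sqrt n}=\ln\frac2\delta\,C\,n^{-\frac12\frac{s\beta}{s\beta+1}},$$ with $C$ independent of $n$ and $\delta$. (ii) If $s+\frac1\beta\le\alpha_0$, then for any $\alpha_0<\alpha\le1$, choose $\nu\asymp(\frac{n}{\ln^r(n)})^{1/\alpha}$ for some $r>1$. Then for any fixed $\delta\in(0,1)$, for $n$ sufficiently large, with probability at least $1-\delta$, $$\big\|T_\nu^{-1/2}\big[(g_Z-T_Xf_\nu)-(g-Tf_\nu)\big]\big\|_{\mathcal H}\le\ln\frac2\delta\,C\frac{\nu^{\frac{\alpha-s}{2}}}{\sqrt n}\le\ln\frac2\delta\,C\Big(\frac{n}{\ln^r(n)}\Big)^{-\frac12\frac s\alpha},$$ with $C$ independent of $n$ and $\delta$.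
   Context: Setting: $\mathcal X\subseteq\mathbb R^d$ compact, $\mathcal Y\subseteq\mathbb R$, $\rho$ on $\mathcal X\times\mathcal Y$ with $\int y^2d\rho<\infty$, marginal $\mu$, $f_\rho^*(x)=\int y\,d\rho(y|x)$. $\mathcal H$ separable RKHS with continuous kernel $k$, $\sup_xk(x,x)\le\kappa^2$. $S_k:\mathcal H\to L^2(\mathcal X,\mu)$ inclusion, $L_k=S_kS_k^*=\sum_i\lambda_i\langle\cdot,e_i\rangle_{L^2}e_i$ ($\lambda_i$ positive non-increasing, $\{e_i\}$ ONB of $\overline{\operatorname{ran}S_k}$, $\{\lambda_i^{1/2}e_i\}$ ONB of $\mathcal H$), $T=S_k^*S_k$, $T_\nu=T+\nu^{-1}I$. $[\mathcal H]^s=\{\sum a_i\lambda_i^{s/2}e_i:(a_i)\in\ell^2\}$ with $\|\sum a_i\lambda_i^{s/2}e_i\|_{[\mathcal H]^s}=\|(a_i)\|_{\ell^2}$. $M_\alpha$ is the smallest $A\ge0$ with $\sum_i\lambda_i^\alpha e_i(x)^2\le A^2$ $\mu$-a.e. $K_x:y\mapsto yk(x,\cdot)$, $K_x^*f=f(x)$, $T_X=\frac1n\sum_iK_{x_i}K_{x_i}^*$, $g_Z=\frac1n\sum_iK_{x_i}y_i$, $g=S_k^*f_\rho^*$. Filter function: $\varphi_\nu:[0,\kappa^2]\to\mathbb R^+$ with $\sup_zz^\alpha\varphi_\nu(z)\le E\nu^{1-\alpha}$ for $\alpha\in[0,1]$ and, for some $\tau\ge1$ (qualification), $\sup_z|1-z\varphi_\nu(z)|z^\alpha\le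 F_\tau\nu^{-\alpha}$ for $\alpha\in[0,\tau]$. $f_\nu=\varphi_\nu(T)g$. (EDR): $ci^{-\beta}\le\lambda_i\le Ci^{-\beta}$ for all $i$. Embedding index $\alpha_0=\inf\{\alpha\in[\frac1\beta,1]:M_\alpha<\infty\}$. (Source): $f_\rho^*\in[\mathcal H]^s$, $\|f_\rho^*\|_{[\mathcal H]^s}\le R$. (Noise): $\epsilon=y-f_\rho^*(x)$ satisfies $\mathbb E(|\epsilon|^m\mid x)\le\frac12m!\sigma^2L^{m-2}$ for all $m\ge2$, $\mu$-a.e. $a_n\asymp b_n$ means $ca_n\le b_n\le Ca_n$ for constants $c,C>0$. *)

(* Defs.v *)
From HB Require Import structures.
From mathcomp Require Import all_boot all_order all_algebra.
From mathcomp Require Import all_classical all_reals all_analysis.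
Set Implicit Arguments. Unset Strict Implicit. Unset Printing Implicit Defensive.
Import Order.TTheory GRing.Theory Num.Theory.
Import numFieldNormedType.Exports.
Local Open Scope classical_set_scope.
Local Open Scope ring_scope.

Definition Rd (R : realType) (d : nat) := g_sigma_algebraType (@open ('rV[R]_d : topologicalType)).

Section defs.
Variables (R : realType) (d : nat).
Local Notation P := (Rd R d).


(* regression function f_rho^*(x) = \int y d rho(y|x), rho(.|x) = K x *)
Definition fstar (K : R.-pker P ~> R) (x : P) : R := Rintegral (K x) setT id.

Definition L2coef (mu : {measure set P -> \bar R}) (f g : P -> R) : R :=
  Rintegral mu setT (fun x => f x * g x).


(* k admits the Mercer expansion k(x,x') = sum_i lam_i e_i(x) e_i(x') on X,
   with lam_i > 0 non-increasing and (e_i) orthonormal in L^2(mu);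
   then {lam_i^(1/2) e_i} is an ONB of the RKHS H of k and an element
   h = sum_i c_i lam_i^(1/2) e_i of H is represented by its coordinates c. *)
Definition mercer_decomposition (Xs : set P) (mu : {measure set P -> \bar R})
    (k : P -> P -> R) (lam : nat -> R) (e : nat -> P -> R) : Prop :=
  [/\ (forall i, 0 < lam i /\ lam i.+1 <= lam i),
      (forall i, measurable_fun setT (e i)),
      (forall i, mu.-integrable setT (fun x => ((e i x) ^+ 2)%:E)),
      (forall i j, L2coef mu (e i) (e j) = (i == j)%:R) &
      (forall x x', Xs x -> Xs x' ->
         (fun N => \sum_(i < N) lam i * e i x * e i x') @ \oo --> k x x')].

(* (EDR) with exponent beta, indices shifted: lam 0 is lambda_1 *)
Definition EDR (lam : nat -> R) (beta : R) : Prop :=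
  exists c C : R, [/\ 0 < c, 0 < C &
    forall i : nat, c * (i.+1%:R) `^ (- beta) <= lam i <= C * (i.+1%:R) `^ (- beta)].

Definition M_finite (mu : {measure set P -> \bar R}) (lam : nat -> R)
    (e : nat -> P -> R) (a : R) : Prop :=
  exists A : R, {ae mu, forall x,
    (\sum_(i <oo) ((lam i `^ a * (e i x) ^+ 2)%:E) <= (A ^+ 2)%:E)%E}.

Definition embedding_index (mu : {measure set P -> \bar R}) (lam : nat -> R)
    (e : nat -> P -> R) (beta : R) : R :=
  inf [set a : R | beta^-1 <= a <= 1 /\ M_finite mu lam e a].

Definition in_interp_ball (mu : {measure set P -> \bar R}) (lam : nat -> R)
    (e : nat -> P -> R) (s Rs : R) (f : P -> R) : Prop :=
  exists a : nat -> R,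
    (\sum_(i <oo) ((a i) ^+ 2)%:E <= (Rs ^+ 2)%:E)%E /\
    (fun N => (\int[mu]_x
        ((f x - \sum_(i < N) a i * lam i `^ (s / 2) * e i x) ^+ 2)%:E)%E)
      @ \oo --> 0%E.

Definition noise_condition (mu : {measure set P -> \bar R}) (K : R.-pker P ~> R)
    (sigma L : R) : Prop :=
  {ae mu, forall x, forall m : nat, (2 <= m)%N ->
    (\int[K x]_y ((`|y - fstar K x| ^+ m)%:E)
       <= (2^-1 * (m`!)%:R * sigma ^+ 2 * L ^+ (m - 2))%:E)%E}.

Definition filter_function (phi : R -> R -> R) (kappa E F tau : R) : Prop :=
  [/\ 1 <= tau,
      (forall nu z, 0 < nu -> 0 <= z <= kappa ^+ 2 -> 0 <= phi nu z),
      (forall nu a z, 0 < nu -> 0 <= a <= 1 -> 0 <= z <= kappa ^+ 2 ->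
          z `^ a * phi nu z <= E * nu `^ (1 - a)) &
      (forall nu a z, 0 < nu -> 0 <= a <= tau -> 0 <= z <= kappa ^+ 2 ->
          `|1 - z * phi nu z| * z `^ a <= F * nu `^ (- a))].

(* f_nu = phi_nu(T) g, evaluated pointwise: its H-coordinates are
   phi_nu(lam_i) lam_i^(1/2) <f*, e_i>, so
   f_nu(x) = sum_i phi_nu(lam_i) lam_i <f*,e_i> e_i(x) *)
Definition f_nu (phi : R -> R -> R) (lam : nat -> R) (e : nat -> P -> R)
    (fs : nat -> R) (nu : R) (x : P) : R :=
  limn (fun N => \sum_(i < N) phi nu (lam i) * lam i * fs i * e i x).

(* i-th H-coordinate of T_nu^(-1/2)[(g_Z - T_X f_nu) - (g - T f_nu)] for the
   sample z_1..z_n; here fs i = <f*, e_i>_{L^2(mu)}: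
   g_Z has coordinates (1/n) sum_j y_j lam_i^(1/2) e_i(x_j),
   T_X f_nu has coordinates (1/n) sum_j f_nu(x_j) lam_i^(1/2) e_i(x_j),
   g - T f_nu has coordinates lam_i^(1/2) (1 - lam_i phi_nu(lam_i)) fs_i,
   T_nu^(-1/2) multiplies the i-th coordinate by (lam_i + 1/nu)^(-1/2). *)
Definition resid_coord (phi : R -> R -> R) (lam : nat -> R) (e : nat -> P -> R)
    (fs : nat -> R) (nu : R) (n : nat) (z : 'I_n -> (P * R)%type) (i : nat) : R :=
  Num.sqrt (lam i / (lam i + nu^-1)) *
  ((n%:R)^-1 * \sum_(j < n) ((z j).2 - f_nu phi lam e fs nu (z j).1) * e i (z j).1
   - (1 - lam i * phi nu (lam i)) * fs i).

Definition resid_sqnorm (phi : R -> R -> R) (lam : nat -> R) (e : nat -> P -> R)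
    (fs : nat -> R) (nu : R) (n : nat) (z : 'I_n -> (P * R)%type) : \bar R :=
  (\sum_(i <oo) ((resid_coord phi lam e fs nu z i) ^+ 2)%:E)%E.

End defs.

Definition iid_sample (R : realType) (dO dT : measure_display)
    (O : measurableType dO) (T : measurableType dT) (Pr : probability O R)
    (rho : probability T R) (n : nat) (Z : 'I_n -> O -> T) : Prop :=
  (forall j, measurable_fun setT (Z j)) /\
  forall B : 'I_n -> set T, (forall j, measurable (B j)) ->
    Pr (\bigcap_(j in [set: 'I_n]) (Z j @^-1` B j)) = (\prod_(j < n) rho (B j))%E.

(* Main.v *)
Require Import Defs.
From HB Require Import structures.
From mathcomp Require Import all_boot all_order all_algebra finmap.
From mathcomp Require Import all_classical all_reals all_analysis.
From mathcomp Require Import measurable_realfun giry ring lra.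
Import Order.TTheory GRing.Theory Num.Theory.
Import numFieldNormedType.Exports.
Local Open Scope classical_set_scope.
Local Open Scope ring_scope.

(* Write h_i = sqrt (lam_i / (lam_i + 1/nu)) e_i.  Coordinatewise the residual is the
   empirical mean of a + b with a_i(x, y) = (y - f(x)) h_i(x) (noise) and
   b_i = (f - f_nu) h_i - E[(f - f_nu) h_i] (bias); both are centred.

   Since the sample size may depend on delta, no exponential inequality is needed.
   The bias part has E|b|^2 <= C nu^(a - s) for any a with M_a finite, and choosing a
   close to alpha0 makes this negligible against the target w = W nu^g, so Markov's
   inequality suffices.  For the noise part, |sum_j a(Z_j)|^2 splits into the diagonal
   sum_j |a(Z_j)|^2 and the U-statistic sum_{j<k} <a(Z_j), a(Z_k)>.  Chebyshev's
   inequality applies to each: the diagonal has small variance by the fourth moment of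
   the noise, and the variance of the U-statistic is at most n^2 times the squared
   Hilbert-Schmidt norm of the covariance of a.  That covariance has bounded operator
   norm and trace at most of order nu^(1/beta), so its squared Hilbert-Schmidt norm is
   at most of order nu^(1/beta), which is small compared with w^2. *)

Set Implicit Arguments.
Unset Strict Implicit.
Unset Printing Implicit Defensive.

(** * Disintegration and independence *)

(** The noise is the obstacle. In part (i) its second moment is controlled only at the order
    [nu ^ (1/beta)] of the target [w] itself, so Markov's inequality would give a bound that does
    not shrink with [n], and the constant would have to grow as [delta] falls. What is small is the
    fluctuation around that moment; hence the second-order argument, while the mean fits under [w]
    by the choice of [W].

    Two properties of the target exponent [g] matter: [g >= 1/beta], so that the trace fits under
    [nu ^ g], and [a < s + g], so that the bias vanishes against it. Part (i) takes [g = 1/beta],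
    part (ii) [g = alpha - s], and one statement serves both. The diagonal needs in addition
    [nu ^ s = O(n)], to absorb the bound of order [nu ^ a] on the sum of the h_i(x)^2.

    The logarithm enters only through [ln (2 / delta) >= 1/2], which a factor 2 in the constant
    absorbs. Probabilities are estimated for finitely many coordinates, with bounds independent of
    their number. *)

Section measurable_ind.
Import HBNNSimple.

(** The standard machine as an induction principle: [f] is the increasing limit of simple functions,
    each a finite sum of scaled indicators. It later extends the factorisation of expectations from
    events to functions. *)
Lemma nonneg_measurable_fun_ind {d} {T : measurableType d} {R : realType}
    (P : (T -> \bar R) -> Prop) :
  (forall A, measurable A -> P (fun x => (\1_A x)%:E)) ->
  (forall f g : T -> \bar R, measurable_fun setT f -> measurable_fun setT g ->
    (forall x, (0 <= f x)%E) -> (forall x, (0 <= g x)%E) ->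
    P f -> P g -> P (fun x => (f x + g x)%E)) ->
  (forall (c : R) (f : T -> \bar R), 0 <= c -> measurable_fun setT f ->
    (forall x, (0 <= f x)%E) -> P f -> P (fun x => (c%:E * f x)%E)) ->
  (forall f_ : nat -> T -> \bar R, (forall n, measurable_fun setT (f_ n)) ->
    (forall n x, (0 <= f_ n x)%E) ->
    (forall x, {homo f_ ^~ x : m n / (m <= n)%N >-> (m <= n)%E}) ->
    (forall n, P (f_ n)) -> P (fun x => limn (f_ ^~ x))) ->
  forall f : T -> \bar R, measurable_fun setT f -> (forall x, (0 <= f x)%E) -> P f.
Proof.
move=> Pind Padd Pscale Plim f mf f0.
pose g := nnsfun_approx measurableT mf.
have -> : f = (fun x => limn (fun n => (g n x)%:E)).
  by apply/funext => x; apply/esym/cvg_lim => //; exact: cvg_nnsfun_approx.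
apply: Plim.
- by move=> n; exact/measurable_EFinP.
- by move=> n x; rewrite lee_fin.
- by move=> x m n mn; rewrite lee_fin; exact/lefP/nd_nnsfun_approx.
move=> n; set h := g n.
have -> : (fun x => (h x)%:E) =
    (fun x => \sum_(r <- fset_set (range h)) (r%:E * (\1_(h @^-1` [set r]) x)%:E))%E.
  apply/funext => x; rewrite fimfunE fsbig_finite/=; last exact: fimfunP.
  by rewrite -sumEFin.
(* The induction over the list of values must remember that they are nonnegative, since [Pscale] is
   granted for such factors only. *)
have : forall r, r \in enum_fset (fset_set (range h)) -> 0 <= r.
  move=> r; rewrite -[_ \in _]/(r \in fset_set (range h)) in_fset_set; last exact: fimfunP.
  by rewrite inE => -[x _ <-]; exact: fun_ge0.
elim: (enum_fset _) => [|r s IH] s0.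
  under [X in P X]eq_fun do rewrite big_nil.
  by have := Pind set0 measurable0; under [X in P X]eq_fun do rewrite indic0.
under [X in P X]eq_fun do rewrite big_cons.
have r0 : 0 <= r by apply: s0; rewrite inE eqxx.
have ms r' : measurable_fun setT (fun x => (\1_(h @^-1` [set r']) x)%:E : \bar R).
  by apply/measurable_EFinP; exact: measurable_indic.
have s0' r' : r' \in s -> 0 <= r' by move=> r's; apply: s0; rewrite inE r's orbT.
apply: Padd.
- exact: measurable_funeM.
- by apply: emeasurable_sum => r'; exact: measurable_funeM.
- by move=> x; rewrite mule_ge0// lee_fin.
- by move=> x; rewrite big_seq; apply: sume_ge0 => r' /s0' ?; rewrite mule_ge0// lee_fin.
- apply: (Pscale r (fun x => (\1_(h @^-1` [set r]) x)%:E)) => //.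
  exact: Pind.
- exact: IH.
Qed.

End measurable_ind.

Section disintegration.
Context {R : realType} {d1 d2 : measure_display} {X : measurableType d1}
  {Y : measurableType d2}.

(** A name for [K x] on which the probability structure is declared, so that it can be used as a
    point of the Giry space. *)
Definition kernel_law (K : R.-pker X ~> Y) (x : X) : set Y -> \bar R := K x.

HB.instance Definition _ K x := Measure.on (kernel_law K x).

HB.instance Definition _ K x :=
  Measure_isProbability.Build _ _ _ (kernel_law K x) (@prob_kernel _ _ _ _ _ K x).

(** The law of (x, y) with y drawn from [K x]. On an event [B] its mass is the integral of the
    indicator of [B] along the kernel, which is measurable in x. *)
Lemma kernel_pair_measurable (K : R.-pker X ~> Y) :
  measurable_fun [set: X]
    (fun x => giry_map (@measurable_pair1 _ _ X Y x) (kernel_law K x : giry Y R)).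
Proof.
apply: measurable_giry_codensity => // B mB.
pose f := fun xy : X * Y => (\1_B xy)%:E : \bar R.
have := @measurable_fun_integral_sfinite_kernel _ _ X Y R f K
  (fun t => _) _.
rewrite (_ : (fun x => \int[K x]_y f (x, y))%E =
  (fun x => giry_map (@measurable_pair1 _ _ X Y x) (kernel_law K x : giry Y R) B)).
  apply; first by move=> ?; rewrite lee_fin.
  by apply/measurable_EFinP; exact: measurable_indic.
apply/funext => x; rewrite /f.
have mxB : measurable ((fun y : Y => (x, y)) @^-1` B).
  by rewrite -[X in measurable X]setTI; exact: measurable_pair1.
by rewrite (_ : giry_map _ _ _ = kernel_law K x ((fun y : Y => (x, y)) @^-1` B))//
  -[X in kernel_law K x X]setIT -integral_indic.
Qed.

(** The Giry bind of [mu] with the laws of (x, y) agrees with [rho] on rectangles, a generating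
    class stable under intersection, hence everywhere; integration against a bind is iterated
    integration. *)
Lemma integral_disintegration (rho : probability (X * Y)%type R)
    (mu : probability X R) (K : R.-pker X ~> Y) (h : X * Y -> \bar R) :
  (forall A B, measurable A -> measurable B ->
     rho (A `*` B) = (\int[mu]_(x in A) K x B)%E) ->
  measurable_fun setT h -> (forall z, (0 <= h z)%E) ->
  (\int[rho]_z h z = \int[mu]_x \int[K x]_y h (x, y))%E.
Proof.
move=> rhoE mh h0.
pose nu := giry_bind (mu : giry X R) (kernel_pair_measurable K).
have nuE A : measurable A -> nu A = (\int[mu]_x K x (xsection A x))%E.
  move=> mA; have := @giry_int_bind _ _ _ _ _ (mu : giry X R) _
    (kernel_pair_measurable K) (fun z => (\1_A z)%:E).
  rewrite /giry_int integral_indic// setIT => ->//; first last.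
  - by apply/measurable_EFinP; exact: measurable_indic.
  apply: eq_integral => x _; rewrite integral_indic// setIT.
  by rewrite /giry_map/= /pushforward xsectionE.
have rhonu A : measurable A -> rho A = nu A.
  move=> mA; pose C : set (set (X * Y)) :=
    [set C | exists A, measurable A /\ exists B, measurable B /\ C = A `*` B].
  apply: (measure_unique C (fun=> setT)) => //.
  - rewrite measurable_prod_measurableType //; congr (<<s _ >>).
    rewrite predeqE; split => [[A' mA' [B mB <-]]|[A' [mA' [B [mB ->]]]]].
      by exists A'; split => //; exists B.
    by exists A' => //; exists B.
  - move=> /= _ _ [X1 [mX1 [X2 [mX2 ->]]]] [Y1 [mY1 [Y2 [mY2 ->]]]].
    rewrite -setXI; exists (X1 `&` Y1); split; first exact: measurableI.
    by exists (X2 `&` Y2); split => //; exact: measurableI.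
  - by move=> _; exists setT; split => //; exists setT; split => //; rewrite setXTT.
  - by rewrite bigcup_const.
  - move=> A0 [A1 [mA1 [B1 [mB1 A0E]]]].
    transitivity (\int[mu]_(x in A1) K x B1)%E; first by rewrite A0E; exact: rhoE.
    transitivity (\int[mu]_x K x (xsection A0 x))%E; last first.
      by apply/esym/nuE; rewrite A0E; exact: measurableX.
    rewrite A0E integral_mkcond; apply: eq_integral => x _; rewrite patchE.
    case: ifPn => xA; first by rewrite in_xsectionX.
    by rewrite notin_xsectionX// measure0.
  - by move=> _; apply: (le_lt_trans (probability_le1 _ _)) => //; rewrite ltry.
transitivity (giry_int nu h).
  by apply: eq_measure_integral => A mA _; exact: rhonu.
rewrite giry_int_bind//; apply: eq_integral => x _.
by rewrite giry_int_map.
Qed.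

End disintegration.

Lemma EFin_Rintegral {d} {T : measurableType d} {R : realType}
    {mu : {measure set T -> \bar R}} {f : T -> R} :
  mu.-integrable setT (EFin \o f) ->
  (Rintegral mu setT f)%:E = (\int[mu]_x (f x)%:E)%E.
Proof. by move=> fi; rewrite /Rintegral fineK//; exact: integrable_fin_num. Qed.

(** * Expectations of products over an i.i.d. sample *)

Section independence.
Context {R : realType} {dO dT : measure_display} {O : measurableType dO}
  {T : measurableType dT} {Pr : probability O R} {rho : probability T R}.

(** Factorisation against indicators extends to nonnegative [G] by the induction principle.
    Integrability of [f] makes its integral a finite factor that moves through the limit. *)
Lemma integral_mul_indep (f : O -> R) (Z : O -> T) (G : T -> \bar R) :
  (forall w, 0 <= f w) -> measurable_fun setT Z ->
  Pr.-integrable setT (EFin \o f) ->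
  (forall B, measurable B ->
    (\int[Pr]_w (f w * \1_B (Z w))%:E = \int[Pr]_w (f w)%:E * rho B)%E) ->
  measurable_fun setT G -> (forall z, (0 <= G z)%E) ->
  (\int[Pr]_w ((f w)%:E * G (Z w)) = \int[Pr]_w (f w)%:E * \int[rho]_z G z)%E.
Proof.
move=> f0 mZ fi find; move: G; have mf := measurable_int _ fi.
have ifin : (\int[Pr]_w (f w)%:E)%E \is a fin_num by exact: integrable_fin_num.
have if0 : (0 <= \int[Pr]_w (f w)%:E)%E by apply: integral_ge0 => w _; rewrite lee_fin.
apply: nonneg_measurable_fun_ind.
- move=> A mA; under eq_integral do rewrite -EFinM.
  by rewrite find// integral_indic// setIT.
- move=> G H mG mH G0 H0 GE HE.
  under eq_integral do rewrite ge0_muleDr//.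
  rewrite ge0_integralD//=; last 4 first.
  + by move=> w _; rewrite mule_ge0// lee_fin.
  + by apply: emeasurable_funM => //; exact: measurableT_comp.
  + by move=> w _; rewrite mule_ge0// lee_fin.
  + by apply: emeasurable_funM => //; exact: measurableT_comp.
  have iG : (0 <= \int[rho]_z G z)%E by exact: integral_ge0.
  have iH : (0 <= \int[rho]_z H z)%E by exact: integral_ge0.
  by rewrite GE HE [in RHS]ge0_integralD// -ge0_muleDr.
- move=> c G c0 mG G0 GE; under eq_integral do rewrite muleCA.
  rewrite ge0_integralZl_EFin//; last 2 first.
  + by move=> w _; rewrite mule_ge0// lee_fin.
  + by apply: emeasurable_funM => //; exact: measurableT_comp.
  by rewrite GE ge0_integralZl_EFin// muleCA.
- move=> G mG G0 ndG GE.
  have Gcvg z : cvgn (G ^~ z) by apply: ereal_nondecreasing_is_cvgn; exact: ndG.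
  transitivity (\int[Pr]_w limn (fun n => (f w)%:E * G n (Z w)))%E.
    by apply: eq_integral => w _; rewrite limeMl.
  rewrite monotone_convergence//; last 3 first.
  + by move=> n; apply: emeasurable_funM => //; exact: measurableT_comp.
  + by move=> n w _; rewrite mule_ge0// lee_fin.
  + by move=> w _ m n mn; rewrite lee_wpmul2l// ?lee_fin//; exact: ndG.
  rewrite [in RHS]monotone_convergence//.
  rewrite -limeMl//; last first.
    apply: ereal_nondecreasing_is_cvgn => m n mn.
    by apply: ge0_le_integral => // z _; exact: ndG.
  by congr (limn _); apply/funext => n; exact: GE.
Qed.

(** Independence is given for events only, so the factors are freed one slot at a time: the claim at
    stage [m] asks the slots from [m] on to be indicators. Stage 0 is the definition of
    independence, stage [n] the result. *)
Lemma ge0_integral_prod_iid (n : nat) (Z : 'I_n -> O -> T) (G : 'I_n -> T -> R) :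
  iid_sample Pr rho Z ->
  (forall j z, 0 <= G j z) -> (forall j, rho.-integrable setT (EFin \o G j)) ->
  (\int[Pr]_w (\prod_(j < n) G j (Z j w))%:E = \prod_(j < n) \int[rho]_z (G j z)%:E)%E.
Proof.
move=> [mZ indep] G0 Gi.
have mG G' : (forall j, rho.-integrable setT (EFin \o G' j)) ->
    forall j, measurable_fun setT (G' j).
  by move=> G'i j; exact/measurable_EFinP/(measurable_int _ (G'i j)).
suff H m : forall G', (forall j z, 0 <= G' j z) ->
    (forall j, rho.-integrable setT (EFin \o G' j)) ->
    (forall j : 'I_n, (m <= j)%N -> exists2 B, measurable B & G' j = \1_B) ->
    (\int[Pr]_w (\prod_(j < n) G' j (Z j w))%:E =
      \prod_(j < n) \int[rho]_z (G' j z)%:E)%E.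
  by apply: (H n) => // j; rewrite leqNgt ltn_ord.
elim: m => [|m IH] G' G'0 G'i G'B.
  pose B j := sval (cid2 (G'B j isT)).
  have mB j : measurable (B j) by rewrite /B; case: cid2.
  have BE j : G' j = \1_(B j) by rewrite /B; case: cid2.
  transitivity (Pr (\bigcap_(j in [set: 'I_n]) (Z j @^-1` B j))).
    rewrite -[X in Pr X]setIT -integral_indic//; last first.
      apply: fin_bigcap_measurable => // j _.
      by rewrite -[X in measurable X]setTI; exact: mZ.
    apply: eq_integral => w _; congr EFin.
    have [wB|wB] := pselect ((\bigcap_(j in [set: 'I_n]) (Z j @^-1` B j)) w).
      rewrite indicE mem_set// big1// => j _; rewrite BE indicE mem_set//; exact: wB.
    rewrite indicE memNset//.
    have /existsNP[j /not_implyP[_ /= jB]] := wB.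
    by rewrite (bigD1 j)//= BE indicE memNset// mul0r.
  rewrite indep//; apply: eq_bigr => j _.
  by rewrite BE integral_indic// setIT.
have [mn|nm] := ltnP m n; last first.
  apply: IH => // j mj.
  by have := leq_ltn_trans mj (leq_trans (ltn_ord j) nm); rewrite ltnn.
pose i0 := Ordinal mn.
(* With an indicator in slot [i0] the previous stage applies. Varying [B] gives the factorisation
   that [integral_mul_indep] asks of the product of the other slots; [B = setT] identifies its
   mean. *)
pose H B j := if j == i0 then \1_B else G' j.
have HE B : measurable B ->
    (\int[Pr]_w ((\prod_(j < n | j != i0) G' j (Z j w)) * \1_B (Z i0 w))%:E =
     (\prod_(j < n | j != i0) \int[rho]_z (G' j z)%:E) * rho B)%E.
  move=> mB.
  have Hi : H B i0 = \1_B by rewrite /H eqxx.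
  have Hj j : j != i0 -> H B j = G' j by rewrite /H => /negbTE ->.
  transitivity (\int[Pr]_w (\prod_(j < n) H B j (Z j w))%:E)%E.
    apply: eq_integral => w _; congr EFin.
    rewrite [RHS](bigD1 i0)//= Hi mulrC; congr (_ * _).
    by apply: eq_bigr => j ji0; rewrite Hj.
  rewrite IH.
  - rewrite (bigD1 i0)//= Hi integral_indic// setIT muleC; congr (_ * _)%E.
    by apply: eq_bigr => j ji0; rewrite Hj.
  - by move=> j z; rewrite /H; case: ifPn => // _; rewrite indicE.
  - by move=> j; rewrite /H; case: ifPn => // _; exact: integrable_indic.
  - move=> j mj; rewrite /H; case: ifPn => [_|ji0]; first by exists B.
    by apply: G'B; rewrite ltn_neqAle mj andbT eq_sym.
have HT := HE setT measurableT; rewrite probability_setT mule1 in HT.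
have HT' : (\int[Pr]_w (\prod_(j < n | j != i0) G' j (Z j w))%:E =
     \prod_(j < n | j != i0) \int[rho]_z (G' j z)%:E)%E.
  by rewrite -HT; apply: eq_integral => w _; rewrite indicT mulr1.
have prod0 w : 0 <= \prod_(j < n | j != i0) G' j (Z j w) by apply: prodr_ge0.
rewrite (bigD1 i0)//= muleC -HT'.
rewrite -(integral_mul_indep (Z := Z i0) (G := EFin \o G' i0))//.
- by apply: eq_integral => w _; rewrite (bigD1 i0)//= mulrC EFinM.
- apply/integrableP; split.
    apply/measurable_EFinP.
    have -> : (fun w => \prod_(j < n | j != i0) G' j (Z j w)) =
        (fun w => \prod_(j < n) if j != i0 then G' j (Z j w) else 1).
      by apply/funext => w; rewrite big_mkcond.
    apply: measurable_prod => j _; case: (j != i0) => //.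
    exact: measurableT_comp (mG _ _ G'i j) (mZ j).
  under eq_integral do rewrite /= ger0_norm//.
  rewrite HT' -ge0_fin_numE; last first.
    by apply: prode_ge0 => j _; apply: integral_ge0 => z _; rewrite lee_fin.
  by apply: prode_fin_num => j _; exact: integrable_fin_num (G'i j).
- by move=> B mB; rewrite HE// HT'.
- by apply: measurableT_comp => //; exact: mG.
- by move=> z; rewrite lee_fin.
Qed.

Lemma integrable_prod_iid (n : nat) (Z : 'I_n -> O -> T) (G : 'I_n -> T -> R) :
  iid_sample Pr rho Z -> (forall j, rho.-integrable setT (EFin \o G j)) ->
  Pr.-integrable setT (fun w => (\prod_(j < n) G j (Z j w))%:E).
Proof.
move=> ZP Gi; have [mZ _] := ZP.
have mG j : measurable_fun setT (G j) by exact/measurable_EFinP/(measurable_int _ (Gi j)).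
apply/integrableP; split.
  apply/measurable_EFinP; apply: measurable_prod => j _.
  exact: measurableT_comp (mG j) (mZ j).
have Gi' j : rho.-integrable setT (EFin \o (fun z => `|G j z|)).
  exact: integrable_norm.
under eq_integral do rewrite /= normr_prod.
rewrite (ge0_integral_prod_iid (G := fun j z => `|G j z|))//.
rewrite -ge0_fin_numE; last first.
  by apply: prode_ge0 => j _; apply: integral_ge0 => z _; rewrite lee_fin.
by apply: prode_fin_num => j _; exact: integrable_fin_num (Gi' j).
Qed.

(** The same slot-by-slot passage, now from nonnegative to signed factors: the product is linear in
    slot [i0], which is split into its positive and negative parts. *)
Lemma Rintegral_prod_iid (n : nat) (Z : 'I_n -> O -> T) (G : 'I_n -> T -> R) :
  iid_sample Pr rho Z -> (forall j, rho.-integrable setT (EFin \o G j)) ->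
  Rintegral Pr setT (fun w => \prod_(j < n) G j (Z j w)) =
  \prod_(j < n) Rintegral rho setT (G j).
Proof.
move=> ZP Gi.
suff H m : forall G' : 'I_n -> T -> R,
    (forall j, rho.-integrable setT (EFin \o G' j)) ->
    (forall j : 'I_n, (m <= j)%N -> forall z, 0 <= G' j z) ->
    Rintegral Pr setT (fun w => \prod_(j < n) G' j (Z j w)) =
    \prod_(j < n) Rintegral rho setT (G' j).
  by apply: (H n) => // j; rewrite leqNgt ltn_ord.
elim: m => [|m IH] G' G'i G'0.
  rewrite /Rintegral ge0_integral_prod_iid//; last by move=> j z; exact: G'0.
  under eq_bigr do rewrite -EFin_Rintegral//.
  by rewrite prodEFin.
have [mn|nm] := ltnP m n; last first.
  apply: IH => // j mj.
  by have := leq_ltn_trans mj (leq_trans (ltn_ord j) nm); rewrite ltnn.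
pose i0 := Ordinal mn.
pose H (g : T -> R) j := if j == i0 then g else G' j.
have Hi g : H g i0 = g by rewrite /H eqxx.
have Hj g j : j != i0 -> H g j = G' j by rewrite /H => /negbTE ->.
have Hint g : rho.-integrable setT (EFin \o g) ->
    forall j, rho.-integrable setT (EFin \o H g j).
  by move=> gi j; rewrite /H; case: ifPn.
have HE g : (forall z, 0 <= g z) -> rho.-integrable setT (EFin \o g) ->
    Rintegral Pr setT (fun w => \prod_(j < n) H g j (Z j w)) =
    Rintegral rho setT g * \prod_(j < n | j != i0) Rintegral rho setT (G' j).
  move=> g0 gi; rewrite IH; last 2 first.
  - exact: Hint.
  - move=> j mj; rewrite /H; case: ifPn => // ji0.
    by apply: G'0; rewrite ltn_neqAle mj andbT eq_sym.
  rewrite (bigD1 i0)//= Hi; congr (_ * _).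
  by apply: eq_bigr => j ji0; rewrite Hj.
pose gp := (G' i0)^\+; pose gn := (G' i0)^\-.
have gpi : rho.-integrable setT (EFin \o gp) by exact: integrable_funrpos.
have gni : rho.-integrable setT (EFin \o gn) by exact: integrable_funrneg.
have gE z : G' i0 z = gp z - gn z by rewrite -[in LHS](funrposBneg (G' i0)).
transitivity (Rintegral Pr setT (fun w => \prod_(j < n) H gp j (Z j w) -
    \prod_(j < n) H gn j (Z j w))).
  apply: eq_Rintegral => w _.
  rewrite (bigD1 i0)//= gE mulrBl [X in _ = X - _](bigD1 i0)//=.
  rewrite [X in _ = _ - X](bigD1 i0)//= !Hi.
  by congr (_ * _ - _ * _); apply: eq_bigr => j ji0; rewrite Hj.
rewrite RintegralB//; last 2 first.
- by apply: integrable_prod_iid => //; exact: Hint.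
- by apply: integrable_prod_iid => //; exact: Hint.
rewrite !HE//; last 2 first.
- by move=> z; exact: funrneg_ge0.
- by move=> z; exact: funrpos_ge0.
rewrite -mulrBl -RintegralB// [RHS](bigD1 i0)//=; congr (_ * _).
by apply: eq_Rintegral => z _; rewrite [RHS]gE.
Qed.

End independence.

(** * Square-integrable functions and moments of i.i.d. sums *)

Lemma measurable_gt {d} {T : measurableType d} {R : realType} (f : T -> R) (t : R) :
  measurable_fun setT f -> measurable [set x | t < f x].
Proof.
move=> mf; rewrite (_ : [set x | _] = f @^-1` `]t, +oo[%classic); last first.
  by apply/seteqP; split => x /=; rewrite in_itv/= andbT.
by rewrite -[X in measurable X]setTI; exact: mf.
Qed.

Section square_integrable.
Context {R : realType} {d : measure_display} {T : measurableType d}.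
Implicit Types (mu : {measure set T -> \bar R}) (f g : T -> R).

(** Measurability of [f] is listed separately because integrability of the square only yields that
    of [f ^+ 2]. *)
Definition sqint mu f : Prop :=
  measurable_fun setT f /\ mu.-integrable setT (fun x => ((f x) ^+ 2)%:E).

Lemma sqint_mul mu f g : sqint mu f -> sqint mu g ->
  mu.-integrable setT (fun x => (f x * g x)%:E).
Proof.
move=> [mf fi] [mg gi].
apply: (le_integrable measurableT _ _ (integrableD measurableT fi gi)).
  by apply/measurable_EFinP; exact: measurable_funM.
move=> x _ /=; rewrite lee_fin normrM [leRHS]ger0_norm ?addr_ge0 ?sqr_ge0//.
rewrite -(real_normK (num_real (f x))) -(real_normK (num_real (g x))).
have := sqr_ge0 (`|f x| - `|g x|).
have := mulr_ge0 (normr_ge0 (f x)) (normr_ge0 (g x)).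
by nra.
Qed.

Lemma sqint_integrable_sqr mu f : sqint mu f ->
  mu.-integrable setT (EFin \o (fun x => (f x) ^+ 2)).
Proof. by case. Qed.

Lemma sqintD mu f g : sqint mu f -> sqint mu g -> sqint mu (fun x => f x + g x).
Proof.
move=> [mf fi] [mg gi]; split; first exact: measurable_funD.
apply: (le_integrable measurableT _ _
  (integrableZl measurableT 2 (integrableD measurableT fi gi))).
  by apply/measurable_EFinP; apply: measurable_funX; exact: measurable_funD.
move=> x _ /=; rewrite lee_fin [leLHS]ger0_norm ?sqr_ge0// [leRHS]ger0_norm ?mulr_ge0 ?addr_ge0 ?sqr_ge0//.
by have := sqr_ge0 (f x - g x); nra.
Qed.

Lemma sqintZ mu c f : sqint mu f -> sqint mu (fun x => c * f x).
Proof.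
move=> [mf fi]; split; first exact: measurable_funM.
have := integrableZl measurableT (c ^+ 2) fi.
by apply: eq_integrable => // x _; rewrite /= exprMn EFinM.
Qed.

Lemma sqintB mu f g : sqint mu f -> sqint mu g -> sqint mu (fun x => f x - g x).
Proof.
move=> fi /(sqintZ (-1)) gi.
have := sqintD fi gi.
by under [X in sqint _ X]eq_fun do rewrite mulN1r.
Qed.

Lemma sqint0 mu : sqint mu (fun=> 0).
Proof.
split; first exact: measurable_cst.
apply: eq_integrable (integrable0 mu setT) => // x _.
by rewrite expr0n.
Qed.

Lemma sqint_sum mu (I : Type) (s : seq I) (h : I -> T -> R) :
  (forall i, sqint mu (h i)) -> sqint mu (fun x => \sum_(i <- s) h i x).
Proof.
move=> hi; elim: s => [|i s IH].
  by under [X in sqint _ X]eq_fun do rewrite big_nil; exact: sqint0.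
by under [X in sqint _ X]eq_fun do rewrite big_cons; exact: sqintD.
Qed.

Lemma sqint_cst (P : probability T R) c : sqint P (fun=> c).
Proof.
split; first exact: measurable_cst.
exact: finite_measure_integrable_cst.
Qed.

Lemma sqint_integrable (P : probability T R) f : sqint P f ->
  P.-integrable setT (EFin \o f).
Proof.
move=> fi; have := sqint_mul fi (sqint_cst P 1).
by apply: eq_integrable => // x _; rewrite mulr1.
Qed.

Lemma integrable_sumR mu (I : Type) (s : seq I) (Q : pred I) (h : I -> T -> R) :
  (forall i, Q i -> mu.-integrable setT (EFin \o h i)) ->
  mu.-integrable setT (fun x => (\sum_(i <- s | Q i) h i x)%:E).
Proof.
move=> hi.
have := @integrable_sum _ T R mu setT measurableT I s Q (fun i => EFin \o h i) hi.
by apply: eq_integrable => // x _; rewrite -sumEFin.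
Qed.

Lemma Rintegral_sum mu (I : Type) (s : seq I) (Q : pred I) (h : I -> T -> R) :
  (forall i, Q i -> mu.-integrable setT (EFin \o h i)) ->
  Rintegral mu setT (fun x => \sum_(i <- s | Q i) h i x) =
  \sum_(i <- s | Q i) Rintegral mu setT (h i).
Proof.
move=> hi; elim: s => [|i s IH].
  rewrite big_nil; under eq_Rintegral do rewrite big_nil.
  by rewrite /Rintegral integral0.
rewrite big_cons; under eq_Rintegral do rewrite big_cons.
case: ifPn => // Qi.
rewrite RintegralD//.
- by rewrite IH.
- exact: hi.
- exact: integrable_sumR.
Qed.

Lemma Rintegral_prob_cst (P : probability T R) (c : R) :
  Rintegral P setT (fun=> c) = c.
Proof. by rewrite Rintegral_cst// [X in fine X]probability_setT mulr1. Qed.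

Lemma markov_gt mu f (t : R) : (forall x, 0 <= f x) ->
  mu.-integrable setT (EFin \o f) -> 0 < t ->
  (mu [set x | (t < f x)%R] <= (Rintegral mu setT f / t)%:E)%E.
Proof.
move=> f0 fi t0; have t0' := ltW t0.
have mf : measurable_fun setT f by exact/measurable_EFinP/(measurable_int _ fi).
have mA : measurable [set x | t < f x] by exact: measurable_gt.
rewrite EFinM EFin_Rintegral// lee_pdivlMr//.
rewrite -[X in mu X]setIT -integral_indic// muleC -ge0_integralZl_EFin//.
- apply: ge0_le_integral => //.
  + by move=> x _; rewrite -EFinM lee_fin mulr_ge0// ltW.
  + by apply/measurable_EFinP; apply: measurable_funM => //; exact: measurable_indic.
  + exact/measurable_EFinP.
  + move=> x _; rewrite -EFinM lee_fin indicE.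
    have [/set_mem/= tx|_] := boolP (x \in [set x | t < f x]).
      by rewrite mulr1 ltW.
    by rewrite mulr0.
- by apply/measurable_EFinP; exact: measurable_indic.
Qed.

End square_integrable.

(** The two sides differ by [m ^+ 2]. *)
Lemma Rintegral_centered_sqr_le {d} {T : measurableType d} {R : realType}
    (P : probability T R) (g : T -> R) (m : R) : sqint P g ->
  Rintegral P setT g = m ->
  Rintegral P setT (fun x => (g x - m) ^+ 2) <= Rintegral P setT (fun x => g x ^+ 2).
Proof.
move=> gs gm; have gi := sqint_integrable gs.
have E z : (g z - m) ^+ 2 = g z ^+ 2 - (2 * m * g z - m ^+ 2) by ring.
have i1 : P.-integrable setT (EFin \o (fun z => 2 * m * g z)).
  have := integrableZl measurableT (2 * m) gi.
  by apply: eq_integrable => // z _; rewrite /= EFinM.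
have i2 : P.-integrable setT (EFin \o (fun z => 2 * m * g z - m ^+ 2)).
  have := integrableB measurableT i1 (finite_measure_integrable_cst P (m ^+ 2) measurableT).
  by apply: eq_integrable.
under eq_Rintegral do rewrite E.
rewrite RintegralB//; last exact: sqint_integrable_sqr.
rewrite RintegralB//; last exact: finite_measure_integrable_cst.
rewrite Rintegral_prob_cst RintegralZl// gm.
by have := sqr_ge0 m; nra.
Qed.

Section iid_moments.
Context {R : realType} {dO dT : measure_display} {O : measurableType dO}
  {T : measurableType dT} {Pr : probability O R} {rho : probability T R}.

(** Pythagoras for a family with a common second moment [h]. It is applied to centred sums over the
    sample and to the U-statistic, where the index runs over pairs. *)
Lemma orthogonal_sum (I : finType) (Q : pred I) (V : I -> O -> R) (h : R) :
  (forall x y, Q x -> Q y -> Pr.-integrable setT (fun w => (V x w * V y w)%:E)) ->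
  (forall x y, Q x -> Q y ->
    Rintegral Pr setT (fun w => V x w * V y w) = if x == y then h else 0) ->
  Pr.-integrable setT (fun w => ((\sum_(x | Q x) V x w) ^+ 2)%:E) /\
  Rintegral Pr setT (fun w => (\sum_(x | Q x) V x w) ^+ 2) = h *+ #|Q|.
Proof.
move=> Vi VE.
have E w : (\sum_(x | Q x) V x w) ^+ 2 = \sum_(x | Q x) \sum_(y | Q y) V x w * V y w.
  by rewrite expr2 big_distrlr.
have i1 x : Q x -> Pr.-integrable setT (EFin \o (fun w => \sum_(y | Q y) V x w * V y w)).
  by move=> Qx; apply: integrable_sumR => y Qy; exact: Vi.
under [X in Pr.-integrable _ X]eq_fun do rewrite E.
split; first exact: integrable_sumR.
under eq_Rintegral do rewrite E.
rewrite Rintegral_sum// -sumr_const; apply: eq_bigr => x Qx.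
rewrite Rintegral_sum; last by move=> y Qy; exact: Vi.
rewrite (bigD1 x)//= VE// eqxx big1 ?addr0// => y /andP[Qy yx].
by rewrite VE// eq_sym (negbTE yx).
Qed.

Lemma prod_two (n : nat) (j k : 'I_n) (x : 'I_n -> R) : j != k ->
  (forall l, l != j -> l != k -> x l = 1) -> \prod_(l < n) x l = x j * x k.
Proof.
move=> jk x1; rewrite (bigD1 j)//=; congr (_ * _).
rewrite (bigD1 k) 1?eq_sym//= big1 ?mulr1// => l /andP[lj lk].
exact: x1.
Qed.

Context {n : nat} {Z : 'I_n -> O -> T} (ZP : iid_sample Pr rho Z).

(** The product formula with the constant 1 in all other slots; the same device gives the next
    lemma. *)
Lemma iid_single (j : 'I_n) (f : T -> R) : rho.-integrable setT (EFin \o f) ->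
  Pr.-integrable setT (fun w => (f (Z j w))%:E) /\
  Rintegral Pr setT (fun w => f (Z j w)) = Rintegral rho setT f.
Proof.
move=> fi; pose G l z := if l == j then f z else 1.
have Gi l : rho.-integrable setT (EFin \o G l).
  by rewrite /G; case: (l == j) => //; exact: finite_measure_integrable_cst.
have GE w : \prod_(l < n) G l (Z l w) = f (Z j w).
  rewrite (bigD1 j)//= /G eqxx big1 ?mulr1// => l lj; by rewrite (negbTE lj).
have := integrable_prod_iid ZP Gi; have := Rintegral_prod_iid ZP Gi.
under eq_Rintegral do rewrite GE; move=> -> Hi; split.
  by move: Hi; under eq_fun do rewrite GE.
rewrite (bigD1 j)//= /G eqxx big1 ?mulr1// => l lj.
by under eq_Rintegral do rewrite (negbTE lj); exact: Rintegral_prob_cst.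
Qed.

Lemma iid_pair (j k : 'I_n) (f g : T -> R) : j != k ->
  rho.-integrable setT (EFin \o f) -> rho.-integrable setT (EFin \o g) ->
  Pr.-integrable setT (fun w => (f (Z j w) * g (Z k w))%:E) /\
  Rintegral Pr setT (fun w => f (Z j w) * g (Z k w)) =
  Rintegral rho setT f * Rintegral rho setT g.
Proof.
move=> jk fi gi; pose G l z := if l == j then f z else if l == k then g z else 1.
have Gi l : rho.-integrable setT (EFin \o G l).
  rewrite /G; case: (l == j) => //; case: (l == k) => //.
  exact: finite_measure_integrable_cst.
have GE w : \prod_(l < n) G l (Z l w) = f (Z j w) * g (Z k w).
  rewrite (prod_two jk); first by rewrite /G !eqxx eq_sym (negbTE jk).
  by move=> l lj lk; rewrite /G (negbTE lj) (negbTE lk).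
have := integrable_prod_iid ZP Gi; have := Rintegral_prod_iid ZP Gi.
under eq_Rintegral do rewrite GE; move=> -> Hi; split.
  by move: Hi; under eq_fun do rewrite GE.
rewrite (prod_two jk); first by rewrite /G !eqxx eq_sym (negbTE jk).
move=> l lj lk; rewrite /G.
by under eq_Rintegral do rewrite (negbTE lj) (negbTE lk); exact: Rintegral_prob_cst.
Qed.

Lemma iid_sum_var (f : T -> R) : sqint rho f -> Rintegral rho setT f = 0 ->
  Pr.-integrable setT (fun w => ((\sum_(j < n) f (Z j w)) ^+ 2)%:E) /\
  Rintegral Pr setT (fun w => (\sum_(j < n) f (Z j w)) ^+ 2) =
  n%:R * Rintegral rho setT (fun z => f z ^+ 2).
Proof.
move=> fs f0; have fi := sqint_integrable fs.
have H : forall j k : 'I_n, Pr.-integrable setT (fun w => (f (Z j w) * f (Z k w))%:E) /\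
    Rintegral Pr setT (fun w => f (Z j w) * f (Z k w)) =
    if j == k then Rintegral rho setT (fun z => f z ^+ 2) else 0.
  move=> j k; have [<-|jk] := eqVneq j k.
    by have := iid_single j (sqint_integrable_sqr fs).
  have [? ->] := iid_pair jk fi fi; split => //.
  by rewrite f0 mulr0.
have [] := @orthogonal_sum 'I_n predT (fun j w => f (Z j w))
    (Rintegral rho setT (fun z => f z ^+ 2)).
- by move=> j k _ _; have [] := H j k.
- by move=> j k _ _; have [] := H j k.
by move=> ? ->; split => //; rewrite card_ord mulr_natl.
Qed.

(** The terms of the U-statistic belonging to different pairs are orthogonal: some sample point
    occurs in exactly one of the two pairs, and there the factor is centred. A single pair
    contributes the squared Hilbert-Schmidt norm of the covariance. *)
Lemma iid_quad (D : nat) (a : 'I_D -> T -> R) :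
  (forall i, sqint rho (a i)) -> (forall i, Rintegral rho setT (a i) = 0) ->
  let U w := \sum_(p : 'I_n * 'I_n | (p.1 < p.2)%N)
      \sum_(i < D) a i (Z p.1 w) * a i (Z p.2 w) in
  Pr.-integrable setT (fun w => (U w ^+ 2)%:E) /\
  Rintegral Pr setT (fun w => U w ^+ 2) <= n%:R ^+ 2 *
    \sum_(i < D) \sum_(i' < D) (Rintegral rho setT (fun z => a i z * a i' z)) ^+ 2.
Proof.
move=> as_ a0 U.
have ai i := sqint_integrable (as_ i).
pose c i i' := Rintegral rho setT (fun z => a i z * a i' z).
pose inp (p : 'I_n * 'I_n) l := (l == p.1) || (l == p.2).
have inp_out (p : 'I_n * 'I_n) l : l != p.1 -> l != p.2 -> inp p l = false.
  by move=> l1 l2; rewrite /inp (negbTE l1) (negbTE l2).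
(* The ordering [p.1 < p.2] matters here: ordered pairs with the same two entries coincide, so
   different pairs differ as sets. *)
have inp_eq (p p' : 'I_n * 'I_n) : (p.1 < p.2)%N -> (p'.1 < p'.2)%N ->
    p != p' -> exists l, inp p l && ~~ inp p' l.
  move=> lp lp' pp'; case: (boolP (inp p' p.1)) => [p1|p1]; last first.
    by exists p.1; rewrite /inp eqxx.
  case: (boolP (inp p' p.2)) => [p2|p2]; last by exists p.2; rewrite /inp eqxx orbT p2.
  exfalso; move/negP: pp'; apply; move: p1 p2 lp lp'; rewrite /inp.
  case: p => p1 p2; case: p' => p1' p2' /=.
  by move=> /orP[]/eqP-> /orP[]/eqP->; rewrite ?ltnn// => h /(ltn_trans h); rewrite ltnn.
have W (p p' : 'I_n * 'I_n) i i' : (p.1 < p.2)%N -> (p'.1 < p'.2)%N ->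
    Pr.-integrable setT (fun w => ((a i (Z p.1 w) * a i (Z p.2 w)) *
       (a i' (Z p'.1 w) * a i' (Z p'.2 w)))%:E) /\
    Rintegral Pr setT (fun w => (a i (Z p.1 w) * a i (Z p.2 w)) *
       (a i' (Z p'.1 w) * a i' (Z p'.2 w))) = if p == p' then c i i' ^+ 2 else 0.
  move=> lp lp'.
  have np : p.1 != p.2 by rewrite neq_ltn lp.
  have np' : p'.1 != p'.2 by rewrite neq_ltn lp'.
  (* Slot [l] collects the factors that either pair puts at the sample point [l], so that
     overlapping pairs are covered by the product formula too. *)
  pose G l z := (if inp p l then a i z else 1) * (if inp p' l then a i' z else 1).
  have Gi l : rho.-integrable setT (EFin \o G l).
    rewrite /G; case: (inp p l); case: (inp p' l).
    - exact: sqint_mul.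
    - by apply: eq_integrable (ai i) => // z _; rewrite /= mulr1.
    - by apply: eq_integrable (ai i') => // z _; rewrite /= mul1r.
    - exact: finite_measure_integrable_cst.
  have GE w : \prod_(l < n) G l (Z l w) = (a i (Z p.1 w) * a i (Z p.2 w)) *
       (a i' (Z p'.1 w) * a i' (Z p'.2 w)).
    rewrite big_split/= (prod_two np); last by move=> l l1 l2; rewrite inp_out.
    rewrite (prod_two np'); last by move=> l l1 l2; rewrite inp_out.
    by rewrite /inp !eqxx !orbT.
  have := integrable_prod_iid ZP Gi; have := Rintegral_prod_iid ZP Gi.
  under eq_Rintegral do rewrite GE; move=> -> Hi; split.
    by move: Hi; under eq_fun do rewrite GE.
  have [pp'|pp'] := eqVneq p p'.
    rewrite (prod_two np); first by rewrite /G -pp' /inp !eqxx !orbT expr2.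
    move=> l l1 l2; rewrite /G -pp' inp_out//.
    by under eq_Rintegral do rewrite mulr1; exact: Rintegral_prob_cst.
  have [l /andP[lp1 lp1']] := inp_eq p p' lp lp' pp'.
  rewrite (bigD1 l)//= /G lp1 (negbTE lp1').
  by under eq_Rintegral do rewrite mulr1; rewrite a0 mul0r.
have E (p p' : 'I_n * 'I_n) w :
    (\sum_(i < D) a i (Z p.1 w) * a i (Z p.2 w)) *
    (\sum_(i < D) a i (Z p'.1 w) * a i (Z p'.2 w)) =
    \sum_(i < D) \sum_(i' < D) (a i (Z p.1 w) * a i (Z p.2 w)) *
       (a i' (Z p'.1 w) * a i' (Z p'.2 w)) by rewrite big_distrlr.
pose H := \sum_(i < D) \sum_(i' < D) c i i' ^+ 2.
have H0 : 0 <= H by apply: sumr_ge0 => i _; apply: sumr_ge0 => i' _; exact: sqr_ge0.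
have [] := @orthogonal_sum _ (fun p : 'I_n * 'I_n => (p.1 < p.2)%N)
  (fun p w => \sum_(i < D) a i (Z p.1 w) * a i (Z p.2 w)) H.
- move=> p p' lp lp'; under eq_fun do rewrite E.
  apply: integrable_sumR => i _; apply: integrable_sumR => i' _.
  by have [] := W p p' i i' lp lp'.
- move=> p p' lp lp'; under eq_Rintegral do rewrite E.
  have Wi i i' := (W p p' i i' lp lp').1.
  rewrite Rintegral_sum; last by move=> i _; apply: integrable_sumR => i' _; exact: Wi.
  under eq_bigr => i _.
    rewrite Rintegral_sum; last by move=> i' _; exact: Wi.
    under eq_bigr do rewrite (W p p' i _ lp lp').2.
    over.
  case: (p == p') => //.
  by rewrite big1// => i _; rewrite big1.
move=> ? ->; split => //.
(* The pairs are counted crudely by [n ^ 2]. *)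
rewrite -[leLHS]mulr_natl; apply: ler_wpM2r => //; rewrite -natrX ler_nat.
by rewrite (leq_trans (max_card _))// card_prod card_ord mulnn.
Qed.

End iid_moments.

(** * Tail of the norm of an i.i.d. sum *)

Lemma sqr_sum_pairs (R : comPzRingType) (n : nat) (x : 'I_n -> R) :
  (\sum_(j < n) x j) ^+ 2 = \sum_(j < n) x j ^+ 2 +
  \sum_(p : 'I_n * 'I_n | (p.1 < p.2)%N) x p.1 * x p.2 *+ 2.
Proof.
rewrite expr2 big_distrlr/= pair_big/= (bigID (fun p => p.1 == p.2))/=; congr (_ + _).
  rewrite (eq_bigr (fun p => x p.1 ^+ 2)); last by move=> p /eqP <-; rewrite expr2.
  rewrite -(pair_big_dep predT (fun i j => i == j) (fun i _ => x i ^+ 2))/=.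
  by apply: eq_bigr => j _; rewrite (big_pred1 j)// => i; rewrite eq_sym.
rewrite (bigID (fun p : 'I_n * 'I_n => (p.1 < p.2)%N))/= sumrMnl mulr2n; congr (_ + _).
  by apply: eq_bigl => p; rewrite neq_ltn; case: ltngtP.
rewrite (reindex_inj (h := fun p : 'I_n * 'I_n => (p.2, p.1)))/=; last first.
  by move=> [i j] [i' j'] [-> ->].
by apply: eq_big => [p|p _]; [rewrite neq_ltn; case: ltngtP|rewrite mulrC].
Qed.

Section concentration.
Context {R : realType} {dO dT : measure_display} {O : measurableType dO}
  {T : measurableType dT} {Pr : probability O R} {rho : probability T R}.
Context {n : nat} {Z : 'I_n -> O -> T} (ZP : iid_sample Pr rho Z).

Lemma measurable_iid_sum (f : T -> R) : measurable_fun setT f ->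
  measurable_fun setT (fun w => \sum_(j < n) f (Z j w)).
Proof.
by move=> mf; apply: measurable_sum => j; exact: measurableT_comp mf (ZP.1 j).
Qed.

(** [w] plays two parts: it bounds the trace, that is the mean of |a|^2, and it sets the scale of
    the three exceptional events, one for the diagonal, one for the U-statistic and one for [b]. *)
Lemma iid_norm_tail (D : nat) (a b : 'I_D -> T -> R) (w Q H V : R) :
  (0 < n)%N -> 0 < w ->
  (forall i, sqint rho (a i)) -> (forall i, Rintegral rho setT (a i) = 0) ->
  sqint rho (fun z => \sum_(i < D) a i z ^+ 2) ->
  (forall i, sqint rho (b i)) -> (forall i, Rintegral rho setT (b i) = 0) ->
  \sum_(i < D) Rintegral rho setT (fun z => a i z ^+ 2) <= w ->
  Rintegral rho setT (fun z => (\sum_(i < D) a i z ^+ 2) ^+ 2) <= Q ->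
  \sum_(i < D) \sum_(i' < D) (Rintegral rho setT (fun z => a i z * a i' z)) ^+ 2 <= H ->
  \sum_(i < D) Rintegral rho setT (fun z => b i z ^+ 2) <= V ->
  (Pr [set o | (10 * w / n%:R <
     \sum_(i < D) (n%:R^-1 * \sum_(j < n) (a i (Z j o) + b i (Z j o))) ^+ 2)%R]
   <= (Q / (n%:R * w ^+ 2) + H / w ^+ 2 + V / w)%:E)%E.
Proof.
move=> n0 w0 as_ a0 As bs b0 aw AQ aH bV.
have nR : 0 < n%:R :> R by rewrite ltr0n.
pose A z := \sum_(i < D) a i z ^+ 2.
pose m := Rintegral rho setT A.
have mE : m = \sum_(i < D) Rintegral rho setT (fun z => a i z ^+ 2).
  by rewrite /m /A Rintegral_sum// => i _; exact: sqint_integrable_sqr.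
pose S1 o := \sum_(j < n) (A (Z j o) - m).
pose U o := \sum_(p : 'I_n * 'I_n | (p.1 < p.2)%N)
      \sum_(i < D) a i (Z p.1 o) * a i (Z p.2 o).
pose S3 o := \sum_(i < D) (\sum_(j < n) b i (Z j o)) ^+ 2.
have Ai : rho.-integrable setT (EFin \o A) by exact: sqint_integrable.
have Ams : sqint rho (fun z => A z - m) by apply: sqintB => //; exact: sqint_cst.
have Am0 : Rintegral rho setT (fun z => A z - m) = 0.
  rewrite RintegralB//; last exact: finite_measure_integrable_cst.
  by rewrite Rintegral_prob_cst subrr.
have varA : Rintegral rho setT (fun z => (A z - m) ^+ 2) <= Q.
  by apply: le_trans AQ; exact: Rintegral_centered_sqr_le.
have [S1i S1E] := iid_sum_var ZP Ams Am0.
have [Ui UE] := iid_quad ZP as_ a0.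
have bi i := iid_sum_var ZP (bs i) (b0 i).
have S3i : Pr.-integrable setT (EFin \o S3) by apply: integrable_sumR => i _; case: (bi i).
have S3E : Rintegral Pr setT S3 <= n%:R * V.
  rewrite /S3 Rintegral_sum; last by move=> i _; case: (bi i).
  under eq_bigr do rewrite (bi _).2.
  by rewrite -mulr_sumr ler_wpM2l// ltW.
pose E1 := [set o | (n%:R * w) ^+ 2 < S1 o ^+ 2].
pose E2 := [set o | (n%:R * w) ^+ 2 < U o ^+ 2].
pose E3 := [set o | n%:R * w < S3 o].
have nw0 : 0 < n%:R * w by exact: mulr_gt0.
have P1 : (Pr E1 <= (Q / (n%:R * w ^+ 2))%:E)%E.
  apply: le_trans (markov_gt _ S1i _) _.
  - by move=> o; exact: sqr_ge0.
  - exact: exprn_gt0.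
  rewrite lee_fin S1E (_ : Q / _ = n%:R * Q / (n%:R * w) ^+ 2); last first.
    by field; rewrite !gt_eqF.
  by rewrite ler_pM2r ?invr_gt0 ?exprn_gt0// ler_wpM2l// ltW.
have P2 : (Pr E2 <= (H / w ^+ 2)%:E)%E.
  apply: le_trans (markov_gt _ Ui _) _.
  - by move=> o; exact: sqr_ge0.
  - exact: exprn_gt0.
  rewrite lee_fin (_ : H / _ = n%:R ^+ 2 * H / (n%:R * w) ^+ 2); last first.
    by field; rewrite !gt_eqF.
  rewrite ler_pM2r ?invr_gt0 ?exprn_gt0//; apply: le_trans UE _.
  by rewrite ler_wpM2l// sqr_ge0.
have P3 : (Pr E3 <= (V / w)%:E)%E.
  apply: le_trans (markov_gt _ S3i _) _ => //.
  - by move=> o; apply: sumr_ge0 => i _; exact: sqr_ge0.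
  rewrite lee_fin (_ : V / w = n%:R * V / (n%:R * w)); last by field; rewrite !gt_eqF.
  by rewrite ler_pM2r ?invr_gt0.
have mint (f : O -> R) : Pr.-integrable setT (EFin \o f) -> measurable_fun setT f.
  by move=> fi; exact/measurable_EFinP/(measurable_int _ fi).
have mE1 : measurable E1 by apply: measurable_gt; exact: mint.
have mE2 : measurable E2 by apply: measurable_gt; exact: mint.
have mE3 : measurable E3 by apply: measurable_gt; exact: mint.
have mE0 : measurable [set o | 10 * w / n%:R <
     \sum_(i < D) (n%:R^-1 * \sum_(j < n) (a i (Z j o) + b i (Z j o))) ^+ 2].
  apply: measurable_gt; apply: measurable_sum => i; apply: measurable_funX.
  apply: measurable_funM => //.
  apply: (measurable_iid_sum (f := fun z => a i z + b i z)).
  by apply: measurable_funD; [case: (as_ i)|case: (bs i)].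
apply: (@le_trans _ _ (Pr (E1 `|` E2 `|` E3))).
  apply: le_measure; rewrite ?inE//; first by do 2 apply: measurableU => //.
  move=> o; apply: contraPP => /=.
  move=> /not_orP[/not_orP[/negP h1 /negP h2] /negP h3].
  rewrite /E1/= -leNgt in h1; rewrite /E2/= -leNgt in h2; rewrite /E3/= -leNgt in h3.
  apply/negP; rewrite -leNgt.
  have abs_le u : u ^+ 2 <= (n%:R * w) ^+ 2 -> u <= n%:R * w.
    by move=> hu; rewrite leNgt; apply/negP => h; nra.
  have S1o := abs_le _ h1; have Uo := abs_le _ h2.
  have AE : \sum_(i < D) (\sum_(j < n) a i (Z j o)) ^+ 2 = S1 o + n%:R * m + 2 * U o.
    under eq_bigr do rewrite sqr_sum_pairs.
    rewrite big_split/= exchange_big/=; congr (_ + _).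
      by rewrite /S1 sumrB sumr_const card_ord mulr_natl subrK.
    rewrite /U exchange_big/= mulr_sumr; apply: eq_bigr => p _.
    by rewrite sumrMnl mulr_natl.
  (* Origin of the 10: off the three events the square of the sum of [a] is at most n w + n w + 2 n
     w and that of [b] at most n w, while (x + y)^2 <= 2 (x^2 + y^2) doubles the total of 5 n w. *)
  apply: (@le_trans _ _ (n%:R^-1 ^+ 2 * (2 *
     (\sum_(i < D) (\sum_(j < n) a i (Z j o)) ^+ 2 + S3 o)))).
    rewrite /S3 -big_split/= !mulr_sumr; apply: ler_sum => i _.
    rewrite exprMn ler_wpM2l ?sqr_ge0// big_split/=.
    set x := \sum_(_ < _) _; set y := \sum_(_ < _) _.
    by have := sqr_ge0 (x - y); nra.
  have mw : n%:R * m <= n%:R * w by rewrite ler_wpM2l ?mE// ltW.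
  rewrite AE (_ : 10 * w / n%:R = n%:R^-1 ^+ 2 * (10 * (n%:R * w))); last first.
    by field; rewrite gt_eqF.
  by rewrite ler_wpM2l ?sqr_ge0//; lra.
apply: le_trans (measureU2 _ _ _) _ => //; first exact: measurableU.
rewrite [leRHS]EFinD; apply: leeD => //.
apply: le_trans (measureU2 _ _ _) _ => //.
by rewrite [leRHS]EFinD; apply: leeD.
Qed.

End concentration.

(** The events that a partial sum exceeds [t] increase with [D], so a bound uniform in [D] passes to
    their union by continuity from below; the series exceeds [t'] only on that union. *)
Lemma nneseries_tail {d} {O : measurableType d} {R : realType} (Pr : probability O R)
    (r : nat -> O -> R) (t t' p : R) :
  (forall i, measurable_fun setT (r i)) -> t <= t' ->
  (forall D, (Pr [set o | (t < \sum_(i < D) r i o ^+ 2)%R] <= p%:E)%E) ->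
  ((1 - p)%:E <= Pr [set o | (\sum_(i <oo) (r i o ^+ 2)%:E <= t'%:E)%E])%E.
Proof.
move=> mr tt' Hp.
pose F D := [set o | t < \sum_(i < D) r i o ^+ 2].
have mF D : measurable (F D).
  apply: measurable_gt; apply: measurable_sum => i; exact: measurable_funX.
have HE : [set o | (\sum_(i <oo) (r i o ^+ 2)%:E <= t'%:E)%E] =
    ~` \bigcup_D [set o | t' < \sum_(i < D) r i o ^+ 2].
  apply/seteqP; split => o /=.
    move=> le_t' [D _ /=]; apply/negP; rewrite -leNgt -lee_fin -sumEFin.
    apply: le_trans le_t'; rewrite -(big_mkord predT (fun i => (r i o ^+ 2)%:E)).
    by apply: nneseries_lim_ge => i _ _; rewrite lee_fin sqr_ge0.
  move=> Ho; apply: lime_le.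
    by apply: is_cvg_nneseries => i _ _; rewrite lee_fin sqr_ge0.
  apply: nearW => D; rewrite big_mkord sumEFin lee_fin leNgt; apply/negP => h.
  by apply: Ho; exists D.
have mU : measurable (\bigcup_D [set o | t' < \sum_(i < D) r i o ^+ 2]).
  apply: bigcup_measurable => D _.
  by apply: measurable_gt; apply: measurable_sum => i; exact: measurable_funX.
have mUF : measurable (\bigcup_D F D) by exact: bigcup_measurable.
have ndF : nondecreasing_seq F.
  move=> m n mn; apply/subsetPset => o /= /lt_le_trans; apply.
  rewrite -(subnKC mn) big_split_ord/= lerDl; apply: sumr_ge0 => i _.
  exact: sqr_ge0.
have PU : (Pr (\bigcup_D F D) <= p%:E)%E.
  have cv := nondecreasing_cvg_mu (mu := Pr) mF mUF ndF.
  rewrite -(cvg_lim _ cv)//; apply: lime_le; first by apply/cvg_ex; eexists; exact: cv.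
  by apply: nearW => D; exact: Hp.
rewrite HE probability_setC// EFinB; apply: leeB => //.
apply: le_trans PU; apply: le_measure; rewrite ?inE//.
by move=> o [D _ /= h]; exists D => //=; exact: le_lt_trans h.
Qed.

(** * Effective dimension *)

Section effective_dimension.
Context {R : realType}.
Implicit Types (beta nu : R) (lam : nat -> R).

(** The right side is the integral of (beta - 1) x^(-beta) over [i, i+1], the left side the minimum
    of the integrand there. The proof uses exp u >= 1 + u twice in place of integration. *)
Lemma powR_telescope beta (i : nat) : 1 < beta -> (0 < i)%N ->
  (beta - 1) * i.+1%:R `^ (- beta) <= i%:R `^ (1 - beta) - i.+1%:R `^ (1 - beta).
Proof.
move=> b1 i0; have x0 : 0 < i%:R :> R by rewrite ltr0n.
have y0 : 0 < i.+1%:R :> R by rewrite ltr0n.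
rewrite /powR !gt_eqF//.
set lx := ln i%:R; set ly := ln i.+1%:R.
have ex : expR lx = i%:R by rewrite lnK.
have ey : expR ly = i.+1%:R by rewrite lnK.
have h1 : i.+1%:R^-1 <= ly - lx.
  have := expR_ge1Dx (lx - ly); rewrite expRD expRN ex ey => h.
  have -> : i.+1%:R^-1 = 1 - i%:R / i.+1%:R :> R.
    by rewrite -[in RHS](natr1 i); field; rewrite natr1 gt_eqF.
  have swap (u v q : R) : 1 + (u - v) <= q -> 1 - q <= v - u by move=> ?; lra.
  exact: swap h.
have h2 := expR_ge1Dx ((beta - 1) * (ly - lx)).
have -> : - beta * ly = (1 - beta) * ly - ly by ring.
have -> : (1 - beta) * lx = (1 - beta) * ly + (beta - 1) * (ly - lx) by ring.
rewrite !expRD expRN ey.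
have e0 := expR_gt0 ((1 - beta) * ly).
have h3 : (beta - 1) * i.+1%:R^-1 <= (beta - 1) * (ly - lx).
  by rewrite ler_wpM2l// subr_ge0 ltW.
rewrite -subr_ge0 (_ : _ - _ = expR ((1 - beta) * ly) *
  (expR ((beta - 1) * (ly - lx)) - 1 - (beta - 1) * i.+1%:R^-1)); last by ring.
apply: mulr_ge0; first exact: ltW.
by rewrite subr_ge0 lerBrDl; apply: le_trans h2; rewrite lerD2l.
Qed.

Lemma powR_tail_sum beta (m D : nat) : 1 < beta -> (0 < m)%N -> (m <= D)%N ->
  \sum_(m <= i < D) i.+1%:R `^ (- beta) <= m%:R `^ (1 - beta) / (beta - 1).
Proof.
move=> b1 m0 mD; rewrite ler_pdivlMr ?subr_gt0// mulrC mulr_sumr.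
apply: (@le_trans _ _ (\sum_(m <= i < D) (i%:R `^ (1 - beta) - i.+1%:R `^ (1 - beta)))).
  rewrite big_nat_cond [leRHS]big_nat_cond; apply: ler_sum => i.
  rewrite andbT => /andP[mi _]; apply: powR_telescope => //.
  exact: leq_trans mi.
rewrite (eq_bigr (fun i => - (i.+1%:R `^ (1 - beta) - i%:R `^ (1 - beta)))); last first.
  by move=> i _; rewrite opprB.
by rewrite sumrN telescope_sumr// opprB gerBl powR_ge0.
Qed.

(** With t = l nu the left side is t / (t + 1), at most min(t, 1), hence at most t^a. The case a = 1
    serves the effective dimension, a general [a] the embedding property. *)
Lemma le_ratio_powR (l nu a : R) : 0 < l -> 0 < nu -> 0 <= a <= 1 ->
  l / (l + nu^-1) <= (l * nu) `^ a.
Proof.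
move=> l0 nu0 /andP[a0 a1].
have t0 : 0 < l * nu by exact: mulr_gt0.
have -> : l / (l + nu^-1) = (l * nu) / (l * nu + 1).
  by field; rewrite !gt_eqF//= addr_gt0.
set t := l * nu in t0 *.
rewrite /powR gt_eqF// ler_pdivrMr ?addr_gt0//.
have et : expR (ln t) = t by rewrite lnK.
have [t1|t1] := leP 1 t.
  have : 1 <= expR (a * ln t) by rewrite -expR0 ler_expR mulr_ge0// ln_ge0.
  by nra.
have : t <= expR (a * ln t).
  rewrite -{1}et ler_expR; have : ln t < 0 by rewrite ln_lt0// t0.
  by nra.
by nra.
Qed.

(** Below the cut [m] each term is at most 1, which gives the 2; beyond it each term is at most nu C
    (i+1)^(-beta), and the tail sum gives [C / (beta - 1)]. *)
Lemma effective_dimension_bound beta lam (C nu : R) (D : nat) :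
  1 < beta -> (forall i, 0 < lam i) ->
  (forall i, lam i <= C * i.+1%:R `^ (- beta)) -> 1 <= nu ->
  \sum_(i < D) lam i / (lam i + nu^-1) <= (2 + C / (beta - 1)) * nu `^ beta^-1.
Proof.
move=> b1 lam0 lamC nu1.
have nu0 : 0 < nu by exact: lt_le_trans nu1.
have b0 : 0 < beta by exact: lt_trans b1.
have p0 i : 0 < i.+1%:R `^ (- beta) :> R by apply: powR_gt0; rewrite ltr0n.
have C0 : 0 <= C.
  by have := le_trans (ltW (lam0 0)) (lamC 0); rewrite pmulr_lge0.
pose N := nu `^ beta^-1.
(* [N] is, up to constants, the index at which the bound on [lam i] reaches [nu^-1]. As [1 <= nu],
   it is at least 1, so rounding it up to [m] at most doubles it. *)
have N1 : 1 <= N by rewrite -(powRr0 nu); apply: ler_powR => //; rewrite invr_ge0 ltW.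
have N0 : 0 < N by exact: lt_le_trans N1.
pose m := (Num.truncn N).+1.
have Nm : N < m%:R by rewrite /m; apply: truncnS_gt.
have mN : m%:R <= 2 * N.
  have : (Num.truncn N)%:R <= N by rewrite truncn_le ltW.
  by rewrite /m -natr1; lra.
have q1 i : lam i / (lam i + nu^-1) <= 1.
  by rewrite ler_pdivrMr ?mul1r ?addr_gt0 ?invr_gt0// lerDl invr_ge0 ltW.
have q2 i : lam i / (lam i + nu^-1) <= nu * C * i.+1%:R `^ (- beta).
  have := @le_ratio_powR (lam i) nu 1 (lam0 i) nu0.
  have t0 : 0 <= lam i * nu by rewrite mulr_ge0// ltW.
  rewrite ler01 lexx powRr1// => /(_ isT) /le_trans; apply.
  by rewrite mulrC -mulrA ler_wpM2l// ltW.
have qpos i : 0 <= lam i / (lam i + nu^-1).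
  by rewrite divr_ge0 ?addr_ge0 ?invr_ge0 ?ltW.
(* Since [N] to the power beta is [nu], the bound is attained with [N] in place of [m]; the exponent
   1 - beta is negative and [N < m]. *)
have numb : nu * m%:R `^ (1 - beta) <= N.
  have -> : 1 - beta = - (beta - 1) by ring.
  rewrite powRN -ler_pdivlMl// mulrC.
  have -> : N / nu = (N `^ (beta - 1))^-1.
    rewrite -powRN -powRrM -[X in _ / X](@powRr1 _ nu) ?ltW// -powRN -powRD.
      by congr (_ `^ _); field; rewrite gt_eqF.
    by rewrite (gt_eqF nu0) implybT.
  have m0 : 0 < m%:R :> R by rewrite ltr0n.
  rewrite lef_pV2 ?posrE ?powR_gt0//.
  by rewrite ge0_ler_powR ?nnegrE ?subr_ge0 ?ltW// (lt_trans N0).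
have h1 k : (k <= m)%N -> \sum_(0 <= i < k) lam i / (lam i + nu^-1) <= 2 * N.
  move=> km; apply: le_trans mN; apply: (@le_trans _ _ (\sum_(0 <= i < k) 1)).
    by apply: ler_sum.
  by rewrite big_const_nat subn0 iter_addr_0 ler_nat.
have h0 : 0 <= C / (beta - 1) * N by rewrite mulr_ge0 ?(ltW N0)// divr_ge0// subr_ge0 ltW.
rewrite -(big_mkord predT (fun i => lam i / (lam i + nu^-1))) mulrDl -/N.
have [Dm|mD] := leqP D m; first by apply: (le_trans (h1 _ Dm)); rewrite lerDl.
rewrite (big_cat_nat (n := m))//=; last exact: ltnW.
apply: lerD; first exact: h1.
apply: (@le_trans _ _ (\sum_(m <= i < D) nu * C * i.+1%:R `^ (- beta))).
  by apply: ler_sum.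
rewrite -mulr_sumr.
apply: (@le_trans _ _ (nu * C * (m%:R `^ (1 - beta) / (beta - 1)))).
  apply: ler_wpM2l; first by rewrite mulr_ge0// ltW.
  by apply: powR_tail_sum => //; exact: ltnW.
rewrite (_ : nu * C * _ = C / (beta - 1) * (nu * m%:R `^ (1 - beta))); last by ring.
by rewrite ler_wpM2l// divr_ge0// subr_ge0 ltW.
Qed.

End effective_dimension.

(** * Measurability of pointwise limits *)

Section limit_measurable.
Context {R : realType} {d : measure_display} {T : measurableType d}.

(** All quantifiers range over the naturals, so that the set of convergence is obtained by countable
    set operations. *)
Lemma cvgn_cauchy_natP (u : nat -> R) :
  cvgn u <-> forall k, exists N, forall m, (N <= m)%N -> `|u m - u N| <= k.+1%:R^-1.
Proof.
split => [/cvg_ex[/= l /cvgrPdist_le ul] k|H].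
  have e0 : 0 < k.+1%:R^-1 / 2 :> R by rewrite divr_gt0.
  have [N _ HN] := ul _ e0.
  exists N => m Nm; have h1 := HN m Nm; have h2 := HN N (leqnn N).
  rewrite /= in h1 h2.
  rewrite (_ : u m - u N = (l - u N) - (l - u m)); last by ring.
  by apply: (le_trans (ler_normB _ _)); rewrite [leRHS]splitr; exact: lerD.
apply/cauchy_cvgP/cauchy_exP => e e0.
have [k _ hk] := near_infty_natSinv_lt (PosNum e0).
have [N HN] := H k.
exists (u N); exists N => // m /= Nm.
rewrite /ball/= distrC (le_lt_trans (HN m Nm))//.
exact: (hk k (leqnn k)).
Qed.

Lemma measurable_fun_limn (u : nat -> T -> R) :
  (forall N, measurable_fun setT (u N)) ->
  measurable_fun setT (fun x => limn (u ^~ x)).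
Proof.
move=> mu.
pose B k N m := [set x | (N <= m)%N -> `|u m x - u N x| <= k.+1%:R^-1].
pose C := \bigcap_k \bigcup_N \bigcap_m B k N m.
have mC : measurable C.
  apply: bigcapT_measurable => k; apply: bigcupT_measurable => N.
  apply: bigcapT_measurable => m.
  rewrite /B; case: (N <= m)%N; last first.
    by rewrite (_ : [set _ | _] = setT)//; apply/seteqP; split => x //= _.
  rewrite (_ : [set _ | _] = ~` [set x | k.+1%:R^-1 < `|u m x - u N x|]).
    apply: measurableC; apply: measurable_gt; apply: measurableT_comp => //.
    exact: measurable_funB.
  apply/seteqP; split => x /=.
    by move=> /(_ isT); rewrite leNgt => /negP.
  by move=> /negP; rewrite -leNgt.
have CE x : C x <-> cvgn (u ^~ x).
  rewrite cvgn_cauchy_natP; split.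
    by move=> H k; have [N _ HN] := H k I; exists N => m; exact: (HN m I).
  by move=> H k _; have [N HN] := H k; exists N => // m _; exact: HN.
apply: (@measurable_fun_cvg _ _ _ _ (fun N x => u N x * \1_C x)) => //.
  by move=> N; apply: measurable_funM => //; exact: measurable_indic.
move=> x _; have [Cx|nCx] := pselect (C x).
  rewrite indicE mem_set//; under eq_fun do rewrite mulr1.
  exact/CE.
rewrite indicE memNset//; under eq_fun do rewrite mulr0.
(* Off [C] the value of [limn] is the default point 0, which is also the limit of the sequence cut
   off by the indicator; hence no convergence assumption. *)
rewrite dvgP; last by move=> /CE.
exact: cvg_cst.
Qed.

End limit_measurable.

(** * Expansions in an orthonormal system *)

Section spectral.
Context {R : realType} {d : measure_display} {X : measurableType d}
  {mu : probability X R}.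

Lemma ae_le_integrable (f g : X -> R) : measurable_fun setT f ->
  mu.-integrable setT (EFin \o g) -> {ae mu, forall x, `|f x| <= g x} ->
  mu.-integrable setT (EFin \o f).
Proof.
move=> mf gi fg; apply/integrableP; split; first exact/measurable_EFinP.
have mg : measurable_fun setT g by exact/measurable_EFinP/(measurable_int _ gi).
have [_ glt] := integrableP _ _ _ gi.
apply: le_lt_trans glt; apply: ae_ge0_le_integral => //.
- by apply/measurable_EFinP; exact: measurableT_comp.
- by apply/measurable_EFinP; exact: measurableT_comp.
by apply: filterS fg => x fg _ /=; rewrite lee_fin (le_trans fg)// ler_norm.
Qed.

Lemma ae_le_Rintegral (f g : X -> R) : (forall x, 0 <= f x) -> (forall x, 0 <= g x) ->
  mu.-integrable setT (EFin \o f) -> mu.-integrable setT (EFin \o g) ->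
  {ae mu, forall x, f x <= g x} -> Rintegral mu setT f <= Rintegral mu setT g.
Proof.
move=> f0 g0 fi gi fg; rewrite -lee_fin !EFin_Rintegral//.
apply: ae_ge0_le_integral => //.
- by move=> x _; rewrite lee_fin.
- exact: measurable_int fi.
- by move=> x _; rewrite lee_fin.
- exact: measurable_int gi.
by apply: filterS fg => x fg _; rewrite lee_fin.
Qed.

(** Bessel's inequality for one unit vector, from the nonnegativity of the squared norm of g - c
    h. *)
Lemma Rintegral_mul_normalized (g h : X -> R) : sqint mu g -> sqint mu h ->
  Rintegral mu setT (fun x => h x * h x) = 1 ->
  (Rintegral mu setT (fun x => g x * h x)) ^+ 2 <=
  Rintegral mu setT (fun x => g x ^+ 2).
Proof.
move=> gs hs h1; set c := Rintegral mu setT (fun x => g x * h x).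
have ghi := sqint_mul gs hs; have hhi := sqint_mul hs hs.
have ggi := sqint_integrable_sqr gs.
have : 0 <= Rintegral mu setT (fun x => (g x - c * h x) ^+ 2).
  by apply: Rintegral_ge0 => x _; exact: sqr_ge0.
have i1 k (f : X -> R) : mu.-integrable setT (EFin \o f) ->
    mu.-integrable setT (EFin \o (fun x => k * f x)).
  move=> /(integrableZl measurableT k).
  by apply: eq_integrable => // x _; rewrite /= EFinM.
have E x : (g x - c * h x) ^+ 2 = g x ^+ 2 - (2 * c * (g x * h x) - c ^+ 2 * (h x * h x)).
  by ring.
under eq_Rintegral do rewrite E.
rewrite RintegralB//; last first.
  have := integrableB measurableT (i1 (2 * c) _ ghi) (i1 (c ^+ 2) _ hhi).
  by apply: eq_integrable.
rewrite RintegralB//; [|exact: i1|exact: i1].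
by rewrite !RintegralZl// h1 -/c; nra.
Qed.

Context {e : nat -> X -> R}.
Hypothesis es : forall i, sqint mu (e i).
Hypothesis eo : forall i j, Rintegral mu setT (fun x => e i x * e j x) = (i == j)%:R.

Lemma sqint_partial_sum (c : nat -> R) (N : nat) :
  sqint mu (fun x => \sum_(i < N) c i * e i x).
Proof. by apply: sqint_sum => i; exact: sqintZ. Qed.

Lemma Rintegral_partial_sum_mul (c : nat -> R) (N i : nat) : (i < N)%N ->
  Rintegral mu setT (fun x => (\sum_(j < N) c j * e j x) * e i x) = c i.
Proof.
move=> iN; have ii j : mu.-integrable setT (EFin \o (fun x => e j x * e i x)).
  exact: sqint_mul.
under eq_Rintegral do rewrite mulr_suml.
rewrite Rintegral_sum; last first.
  move=> j _; have := integrableZl measurableT (c j) (ii j).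
  by apply: eq_integrable => // x _; rewrite /= -EFinM mulrA.
under eq_bigr => j _.
  under eq_Rintegral do rewrite -mulrA.
  rewrite RintegralZl// eo.
  over.
rewrite (bigD1 (Ordinal iN))//= eqxx mulr1 big1 ?addr0// => j ji.
suff -> : (j == i :> nat) = false by rewrite mulr0.
by apply: contra_neqF ji => /eqP ji; apply/val_inj.
Qed.

Lemma Rintegral_partial_sum_sqr (c : nat -> R) (N : nat) :
  Rintegral mu setT (fun x => (\sum_(j < N) c j * e j x) ^+ 2) = \sum_(j < N) c j ^+ 2.
Proof.
have ii j : mu.-integrable setT (EFin \o
    (fun x => (\sum_(j < N) c j * e j x) * (c j * e j x))).
  by apply: sqint_mul; [exact: sqint_partial_sum|exact: sqintZ].
under eq_Rintegral do rewrite expr2 mulr_sumr.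
rewrite Rintegral_sum//; apply: eq_bigr => j _.
under eq_Rintegral do rewrite mulrCA.
rewrite RintegralZl//; last by apply: sqint_mul => //; exact: sqint_partial_sum.
by rewrite Rintegral_partial_sum_mul// expr2.
Qed.

(** Coefficients pass to L^2 limits: by Bessel's inequality the squared error of the coefficient is
    at most the squared distance from [g] to [h N]. *)
Lemma cvg_Rintegral_mul (h : nat -> X -> R) (i : nat) (l : R) (g : X -> R) :
  sqint mu g -> (forall N, sqint mu (h N)) ->
  (fun N => Rintegral mu setT (fun x => (g x - h N x) ^+ 2)) @ \oo --> (0 : R) ->
  (forall N, (i < N)%N -> Rintegral mu setT (fun x => h N x * e i x) = l) ->
  Rintegral mu setT (fun x => g x * e i x) = l.
Proof.
move=> gs hs h0 hl; apply/eqP; rewrite -subr_eq0 -sqrf_eq0; apply/eqP.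
apply/eqP; rewrite eq_le sqr_ge0 andbT.
rewrite -(cvg_lim _ h0)//; apply: limr_ge; first exact: cvgP h0.
exists i.+1 => // N /= iN.
have -> : Rintegral mu setT (fun x => g x * e i x) - l =
    Rintegral mu setT (fun x => (g x - h N x) * e i x).
  rewrite -(hl N iN) -RintegralB//; last 2 first.
  - exact: sqint_mul.
  - exact: sqint_mul.
  by apply: eq_Rintegral => x _; rewrite mulrBl.
apply: Rintegral_mul_normalized => //; first exact: sqintB.
by rewrite eo eqxx.
Qed.

Context {lam : nat -> R} {kap2 : R}.
Hypothesis lam0 : forall i, 0 < lam i.
Hypothesis ek : {ae mu, forall x N, \sum_(i < N) lam i * e i x ^+ 2 <= kap2}.

Lemma kap2_ge0 : 0 <= kap2.
Proof.
have mu0 : (0 < mu setT)%E by rewrite probability_setT.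
have [x] := @filter_ex _ _ (ae_properfilter_algebraOfSetsType mu0) _ ek.
by move=> /(_ 0%N); rewrite big_ord0.
Qed.

(** [lam i] is the mean of lam_i e_i^2, a single term of the bounded sum. This places the spectrum
    in the interval on which the filter is controlled. *)
Lemma eigenvalue_le i : lam i <= kap2.
Proof.
have ei := sqint_mul (es i) (es i).
have -> : lam i = Rintegral mu setT (fun x => lam i * (e i x * e i x)).
  by rewrite RintegralZl// eo eqxx mulr1.
rewrite -[leRHS](Rintegral_prob_cst mu); apply: ae_le_Rintegral.
- by move=> x; rewrite mulr_ge0 ?(ltW (lam0 i))// -expr2 sqr_ge0.
- by move=> _; exact: kap2_ge0.
- have := integrableZl measurableT (lam i) ei.
  by apply: eq_integrable => // x _; rewrite /= EFinM.
- exact: finite_measure_integrable_cst.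
apply: filterS ek => x /(_ i.+1); rewrite big_ord_recr/= expr2.
apply: le_trans; rewrite lerDr; apply: sumr_ge0 => j _.
by rewrite mulr_ge0 ?sqr_ge0// ltW.
Qed.

(** * Convergence and coefficients of the series for the regularized solution *)

Section filtered_series.
Context {c : nat -> R} {S : R}.
Hypothesis cS : forall N, \sum_(i < N) c i ^+ 2 <= S.
Let u N x := \sum_(i < N) c i * lam i * e i x.
Let v x := limn (u ^~ x).

(** Absolute convergence from |c e| <= c^2 + e^2, multiplied by [lam i], with [lam i <= kap2] used
    in the first term only. The bound depends neither on [N] nor on the point, so it also dominates
    in the L^2 limit. *)
Lemma filtered_series_cvg : {ae mu, forall x,
  (forall N, `|u N x| <= kap2 * S + kap2) /\ (u ^~ x) @ \oo --> v x}.
Proof.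
apply: filterS ek => x exk.
have k0 := kap2_ge0.
have abs_le N : \sum_(i < N) `|c i * lam i * e i x| <= kap2 * S + kap2.
  apply: (@le_trans _ _ (\sum_(i < N) (kap2 * c i ^+ 2 + lam i * e i x ^+ 2))).
    apply: ler_sum => i _.
    have l0 := lam0 i; have lk := eigenvalue_le i.
    rewrite !normrM (gtr0_norm l0).
    rewrite -(real_normK (num_real (c i))) -(real_normK (num_real (e i x))).
    have := normr_ge0 (c i); have := normr_ge0 (e i x).
    move: `|c i| `|e i x| => p q q0 p0.
    apply: (@le_trans _ _ (lam i * p ^+ 2 + lam i * q ^+ 2)).
      rewrite mulrAC mulrC -mulrDr; apply: ler_wpM2l; first exact: ltW.
      by have := sqr_ge0 (p - q); nra.
    by rewrite lerD2r ler_wpM2r// sqr_ge0.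
  rewrite big_split/= -mulr_sumr; apply: lerD; last exact: exk.
  by apply: ler_wpM2l => //; exact: cS.
split => [N|]; first exact: le_trans (ler_norm_sum _ _ _) _.
pose a i := c i * lam i * e i x.
have uE : u ^~ x = series a by apply/funext => N; rewrite /u /series/= big_mkord.
suff : cvgn (u ^~ x) by [].
rewrite uE; apply: normed_cvg; apply: nondecreasing_is_cvgn.
  by apply: nondecreasing_series => n _ _; exact: normr_ge0.
by exists (kap2 * S + kap2) => _ [N _ <-]; rewrite /= seriesEord/=; exact: abs_le.
Qed.

Lemma measurable_filtered_series : measurable_fun setT v.
Proof.
apply: measurable_fun_limn => N; apply: measurable_sum => i.
by apply: measurable_funM => //; case: (es i).
Qed.

Lemma sqint_filtered_series : sqint mu v.
Proof.
split; first exact: measurable_filtered_series.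
have mv := measurable_filtered_series.
apply: (@ae_le_integrable (fun x => v x ^+ 2) (cst ((kap2 * S + kap2) ^+ 2))).
- exact: measurable_funX.
- exact: finite_measure_integrable_cst.
apply: filterS filtered_series_cvg => x [ux uv] /=.
rewrite normrX lerXn2r ?nnegrE//; first by apply: le_trans (ux 0%N).
have nuv : `|u N x| @[N --> \oo] --> `|v x| by exact: cvg_norm.
rewrite -(cvg_lim _ nuv)//.
apply: limr_le; first exact: cvgP nuv.
by apply: nearW.
Qed.

Lemma filtered_series_L2_cvg :
  (fun N => Rintegral mu setT (fun x => (v x - u N x) ^+ 2)) @ \oo --> (0 : R).
Proof.
have mv := measurable_filtered_series.
have mu_ N : measurable_fun setT (u N).
  apply: measurable_sum => i.
  by apply: measurable_funM => //; case: (es i).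
have [|||||_ _] := @dominated_convergence _ _ _ mu setT measurableT
  (fun N x => ((v x - u N x) ^+ 2)%:E) (cst 0%E)
  (cst (((2 * (kap2 * S + kap2)) ^+ 2)%:E)).
- move=> N; apply/measurable_EFinP; apply: measurable_funX.
  exact: measurable_funB.
- exact: measurable_cst.
- apply: filterS filtered_series_cvg => x [_ uv] _.
  apply/fine_cvgP; split; first exact: nearW.
  rewrite (_ : 0 = (v x - v x) ^+ 2); last by rewrite subrr expr0n.
  apply: (@cvg_comp _ _ _ (fun N => v x - u N x) (fun y => y ^+ 2) _ (nbhs (v x - v x))).
    by apply: cvgB => //; exact: cvg_cst.
  exact: exprn_continuous.
- exact: finite_measure_integrable_cst.
- apply: filterS filtered_series_cvg => x [ux uv] N _ /=.
  have vx : `|v x| <= kap2 * S + kap2.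
    have nuv : `|u N x| @[N --> \oo] --> `|v x| by exact: cvg_norm.
    rewrite -(cvg_lim _ nuv)//; apply: limr_le; first exact: cvgP nuv.
    by apply: nearW.
  rewrite lee_fin normrX lerXn2r ?nnegrE//.
    by rewrite mulr_ge0// (le_trans _ vx).
  by rewrite (le_trans (ler_normB _ _))// mulr2n mulrDl !mul1r lerD.
rewrite integral0 => /fine_cvgP[_ H].
exact: H.
Qed.

Lemma filtered_series_coef i :
  Rintegral mu setT (fun x => v x * e i x) = c i * lam i.
Proof.
apply: (@cvg_Rintegral_mul u).
- exact: sqint_filtered_series.
- by move=> N; exact: (sqint_partial_sum (fun i => c i * lam i)).
- exact: filtered_series_L2_cvg.
- move=> N iN; exact: (Rintegral_partial_sum_mul (fun i => c i * lam i)).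
Qed.

(** At truncation level N the difference splits into the two remainders and a finite sum whose norm
    is known exactly. The 3 comes from (p + q - r)^2 <= 3 (p^2 + q^2 + r^2); the remainders vanish
    as N grows. *)
Lemma filtered_series_bias (f : X -> R) (b : nat -> R) (V : R) : sqint mu f ->
  (fun N => Rintegral mu setT (fun x => (f x - \sum_(i < N) b i * e i x) ^+ 2))
    @ \oo --> (0 : R) ->
  (forall N, \sum_(i < N) (b i - c i * lam i) ^+ 2 <= V) ->
  Rintegral mu setT (fun x => (f x - v x) ^+ 2) <= 3 * V.
Proof.
move=> fs fb bV.
have vs := sqint_filtered_series.
pose g N x := f x - \sum_(i < N) b i * e i x.
pose h N x := v x - u N x.
pose m N x := \sum_(i < N) (b i - c i * lam i) * e i x.
have gs N : sqint mu (g N) by apply: sqintB => //; exact: sqint_partial_sum.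
have us N : sqint mu (u N) by exact: (sqint_partial_sum (fun i => c i * lam i)).
have hs N : sqint mu (h N) by exact: sqintB.
have ms N : sqint mu (m N) by exact: (sqint_partial_sum (fun i => b i - c i * lam i)).
have H N : Rintegral mu setT (fun x => (f x - v x) ^+ 2) <=
    3 * (Rintegral mu setT (fun x => g N x ^+ 2) +
         Rintegral mu setT (fun x => h N x ^+ 2)) + 3 * V.
  have E x : f x - v x = g N x + m N x - h N x.
    have -> : m N x = \sum_(i < N) b i * e i x - u N x.
      by rewrite /m /u -sumrB; apply: eq_bigr => i _; rewrite mulrBl.
    by rewrite /g /h; ring.
  have i3 : mu.-integrable setT (EFin \o (fun x => g N x ^+ 2 + h N x ^+ 2 + m N x ^+ 2)).
    have := integrableD measurableT (integrableD measurableT (gs N).2 (hs N).2) (ms N).2.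
    by apply: eq_integrable.
  apply: (@le_trans _ _ (Rintegral mu setT
      (fun x => 3 * (g N x ^+ 2 + h N x ^+ 2 + m N x ^+ 2)))).
    apply: le_Rintegral => //.
    - by case: (sqintB fs vs).
    - have := integrableZl measurableT 3 i3.
      by apply: eq_integrable => // x _; rewrite /= EFinM.
    move=> x _; rewrite E.
    have := sqr_ge0 (g N x - m N x); have := sqr_ge0 (g N x + h N x).
    have := sqr_ge0 (m N x + h N x); move: (g N x) (m N x) (h N x) => p q r.
    by nra.
  rewrite RintegralZl//.
  have -> : Rintegral mu setT (fun x => g N x ^+ 2 + h N x ^+ 2 + m N x ^+ 2) =
      Rintegral mu setT (fun x => g N x ^+ 2) + Rintegral mu setT (fun x => h N x ^+ 2)
      + Rintegral mu setT (fun x => m N x ^+ 2).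
    have i2 : mu.-integrable setT (EFin \o (fun x => g N x ^+ 2 + h N x ^+ 2)).
      have := integrableD measurableT (gs N).2 (hs N).2.
      by apply: eq_integrable.
    rewrite RintegralD//; last by case: (ms N).
    by rewrite RintegralD//; [case: (gs N)|case: (hs N)].
  rewrite mulrDr lerD2l ler_wpM2l//.
  by rewrite (Rintegral_partial_sum_sqr (fun i => b i - c i * lam i)).
have L : (fun N => 3 * (Rintegral mu setT (fun x => g N x ^+ 2) +
         Rintegral mu setT (fun x => h N x ^+ 2)) + 3 * V) @ \oo --> 3 * (0 + 0) + 3 * V.
  apply: cvgD; last exact: cvg_cst.
  apply: cvgM; first exact: cvg_cst.
  by apply: cvgD => //; exact: filtered_series_L2_cvg.
rewrite addr0 mulr0 add0r in L.
rewrite -(cvg_lim _ L)//; apply: limr_ge; first exact: cvgP L.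
exact: nearW.
Qed.

End filtered_series.

(** Square-integrability of [f] is a conclusion: integrals tending to 0 are eventually finite, and
    [f] is such a remainder plus a finite sum. *)
Lemma L2_expansion (f : X -> R) (b : nat -> R) : measurable_fun setT f ->
  (fun N => (\int[mu]_x ((f x - \sum_(i < N) b i * e i x) ^+ 2)%:E)%E) @ \oo --> 0%E ->
  [/\ sqint mu f,
    (fun N => Rintegral mu setT (fun x => (f x - \sum_(i < N) b i * e i x) ^+ 2))
    @ \oo --> (0 : R) &
    forall i, Rintegral mu setT (fun x => f x * e i x) = b i].
Proof.
move=> mf /fine_cvgP[[N _ fin] cv].
have ps M := sqint_partial_sum b M.
have fs : sqint mu f.
  have gs : sqint mu (fun x => f x - \sum_(i < N) b i * e i x).
    have mg : measurable_fun setT (fun x => f x - \sum_(i < N) b i * e i x).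
      by apply: measurable_funB => //; case: (ps N).
    split => //; apply/integrableP; split.
      by apply/measurable_EFinP; exact: measurable_funX.
    under eq_integral do rewrite /= ger0_norm ?sqr_ge0//.
    rewrite -ge0_fin_numE; first exact: (fin N (leqnn N)).
    by apply: integral_ge0 => x _; rewrite lee_fin sqr_ge0.
  have := sqintD gs (ps N).
  by under [X in sqint _ X]eq_fun do rewrite subrK.
split => // i.
apply: (@cvg_Rintegral_mul (fun N x => \sum_(i < N) b i * e i x)) => //.
by move=> M iM; exact: Rintegral_partial_sum_mul.
Qed.

End spectral.

(** * Regression noise *)

Section regression_noise.
Context {R : realType} {d : measure_display} {X : measurableType d}.
Context {rho : probability (X * R)%type R} {mu : probability X R} {K : R.-pker X ~> R}.
Hypothesis rhoE : forall (A : set X) (B : set R), measurable A -> measurable B ->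
  rho (A `*` B) = (\int[mu]_(x in A) K x B)%E.

Let f (x : X) : R := Rintegral (K x) setT id.

Lemma measurable_regression : measurable_fun setT f.
Proof.
have mK U : measurable U -> measurable_fun [set: X] (K ^~ U) by exact: measurable_kernel.
apply: (measurableT_comp (f := fine)); first exact: fine_measurable.
under eq_fun do rewrite integralE.
by apply: emeasurable_funB; apply: measurable_fun_integral_kernel => //;
  [exact: measurable_funepos|exact: measurable_funeneg].
Qed.

Let eps (z : X * R) : R := z.2 - f z.1.

Lemma measurable_noise : measurable_fun setT eps.
Proof.
by apply: measurable_funB => //; exact: measurableT_comp measurable_regression _.
Qed.

Lemma ge0_integral_marginal (g : X -> \bar R) : measurable_fun setT g ->
  (forall x, (0 <= g x)%E) -> (\int[rho]_z g z.1 = \int[mu]_x g x)%E.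
Proof.
move=> mg g0; rewrite (integral_disintegration rhoE)//; last exact: measurableT_comp.
apply: eq_integral => x _; rewrite /= -[LHS]/(\int[K x]_y cst (g x) y)%E.
rewrite integral_cst//.
by rewrite (@prob_kernel _ _ _ _ _ K) mule1.
Qed.

Lemma integral_marginal (g : X -> \bar R) : measurable_fun setT g ->
  (\int[rho]_z g z.1 = \int[mu]_x g x)%E.
Proof.
move=> mg; rewrite [LHS]integralE [RHS]integralE; congr (_ - _)%E.
  by rewrite -(ge0_integral_marginal (measurable_funepos mg) (funepos_ge0 g)); apply: eq_integral => z _; rewrite !funeposE.
by rewrite -(ge0_integral_marginal (measurable_funeneg mg) (funeneg_ge0 g)); apply: eq_integral => z _; rewrite !funenegE.
Qed.

Lemma integrable_marginal (g : X -> \bar R) : mu.-integrable setT g ->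
  rho.-integrable setT (fun z => g z.1).
Proof.
move=> /integrableP[mg gi]; apply/integrableP; split; first exact: measurableT_comp.
by rewrite (ge0_integral_marginal (g := fun x => `|g x|%E))//; exact: measurableT_comp.
Qed.

Lemma Rintegral_marginal (g : X -> R) : measurable_fun setT g ->
  Rintegral rho setT (fun z => g z.1) = Rintegral mu setT g.
Proof.
move=> mg; rewrite /Rintegral; congr fine.
by rewrite -[RHS]integral_marginal//; exact/measurable_EFinP.
Qed.

Lemma sqint_marginal (g : X -> R) : sqint mu g -> sqint rho (fun z => g z.1).
Proof.
move=> [mg gi]; split; first exact: measurableT_comp.
exact: (integrable_marginal (g := fun x => (g x ^+ 2)%:E)).
Qed.

Lemma integral_noise_pow_le (m : nat) (B : R) (g : X -> R) : 0 <= B ->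
  {ae mu, forall x, (\int[K x]_y (`|y - f x| ^+ m)%:E <= B%:E)%E} ->
  measurable_fun setT g -> (forall x, 0 <= g x) ->
  (\int[rho]_z (`|eps z| ^+ m * g z.1)%:E <= B%:E * \int[mu]_x (g x)%:E)%E.
Proof.
move=> B0 KB mg g0.
have meps := measurable_noise.
have me : measurable_fun setT (fun z => (`|eps z| ^+ m)%:E).
  apply/measurable_EFinP; apply: measurable_funX; exact: measurableT_comp.
have mh : measurable_fun setT (fun z => (`|eps z| ^+ m * g z.1)%:E).
  apply/measurable_EFinP; apply: measurable_funM; first exact/measurable_EFinP.
  exact: measurableT_comp.
rewrite (integral_disintegration rhoE)//; last first.
  by move=> z; rewrite lee_fin mulr_ge0.
rewrite -ge0_integralZl_EFin//; last 2 first.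
- by move=> x _; rewrite lee_fin.
- exact/measurable_EFinP.
have inner x : (\int[K x]_y (`|eps (x, y)| ^+ m * g x)%:E =
    (g x)%:E * \int[K x]_y (`|y - f x| ^+ m)%:E)%E.
  rewrite -ge0_integralZl_EFin//.
  - by apply: eq_integral => y _; rewrite -EFinM mulrC.
  - apply/measurable_EFinP; apply: measurable_funX; apply: measurableT_comp => //.
    exact: measurable_funB.
have minner : measurable_fun setT
    (fun x => \int[K x]_y (`|eps (x, y)| ^+ m * g x)%:E)%E.
  apply: (measurable_fun_integral_sfinite_kernel
    (fun z : X * R => (`|eps z| ^+ m * g z.1)%:E) K) => //.
  by move=> z; rewrite lee_fin mulr_ge0.
apply: ae_ge0_le_integral => //.
- by move=> x _; apply: integral_ge0 => y _; rewrite lee_fin mulr_ge0.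
- by move=> x _; rewrite mule_ge0// lee_fin.
- by apply: measurable_funeM; exact/measurable_EFinP.
apply: filterS KB => x KB _; rewrite inner muleC.
by apply: lee_wpmul2r => //; rewrite lee_fin.
Qed.

Lemma integrable_noise_pow (m : nat) (B : R) (g : X -> R) : 0 <= B ->
  {ae mu, forall x, (\int[K x]_y (`|y - f x| ^+ m)%:E <= B%:E)%E} ->
  mu.-integrable setT (EFin \o g) -> (forall x, 0 <= g x) ->
  rho.-integrable setT (fun z => (`|eps z| ^+ m * g z.1)%:E) /\
  Rintegral rho setT (fun z => `|eps z| ^+ m * g z.1) <= B * Rintegral mu setT g.
Proof.
move=> B0 KB gi g0.
have mg : measurable_fun setT g by exact/measurable_EFinP/(measurable_int _ gi).
have le := integral_noise_pow_le B0 KB mg g0.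
have i1 : rho.-integrable setT (fun z => (`|eps z| ^+ m * g z.1)%:E).
  apply/integrableP; split.
    apply/measurable_EFinP; apply: measurable_funM; last exact: measurableT_comp.
    by apply: measurable_funX; apply: measurableT_comp => //; exact: measurable_noise.
  under eq_integral do rewrite /= ger0_norm ?mulr_ge0//.
  apply: le_lt_trans le _; rewrite -EFin_Rintegral// -EFinM.
  exact: ltry.
split => //.
by rewrite -lee_fin EFin_Rintegral// EFinM EFin_Rintegral.
Qed.

Context {sig2 : R}.
Hypothesis sig20 : 0 <= sig2.
Hypothesis K2 : {ae mu, forall x, (\int[K x]_y (`|y - f x| ^+ 2)%:E <= sig2%:E)%E}.

Lemma noise_sqint (h : X -> R) : sqint mu h ->
  sqint rho (fun z => eps z * h z.1) /\
  Rintegral rho setT (fun z => (eps z * h z.1) ^+ 2) <=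
    sig2 * Rintegral mu setT (fun x => h x ^+ 2).
Proof.
move=> [mh hi].
have [i1 le] := integrable_noise_pow sig20 K2 hi (fun x => sqr_ge0 (h x)).
have E z : (eps z * h z.1) ^+ 2 = `|eps z| ^+ 2 * h z.1 ^+ 2.
  by rewrite exprMn real_normK ?num_real.
split; last by under eq_Rintegral do rewrite E.
split; last by under eq_fun do rewrite E.
by apply: measurable_funM; [exact: measurable_noise|exact: measurableT_comp].
Qed.

(** The disintegration formula is for nonnegative functions, so the positive and negative parts are
    disintegrated separately; their conditional integrals agree for almost every x, the conditional
    mean of the noise being 0. *)
Lemma noise_centered (h : X -> R) : sqint mu h ->
  Rintegral rho setT (fun z => eps z * h z.1) = 0.
Proof.
move=> hs; have [es _] := noise_sqint hs.
have ei := sqint_integrable es.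
pose g z := (eps z * h z.1)%:E : \bar R.
have mg : measurable_fun setT g by exact: measurable_int ei.
rewrite /Rintegral -/g integralE.
have gpi := integrable_funepos measurableT ei.
have gni := integrable_funeneg measurableT ei.
have E : (\int[rho]_z g^\+ z = \int[rho]_z g^\- z)%E.
  rewrite !(integral_disintegration rhoE)//; last 2 first.
  - exact: measurable_funeneg.
  - exact: measurable_funepos.
  apply: ge0_ae_eq_integral => //.
  - apply: (measurable_fun_integral_sfinite_kernel (g^\+)%E K) => //.
    exact: measurable_funepos.
  - apply: (measurable_fun_integral_sfinite_kernel (g^\-)%E K) => //.
    exact: measurable_funeneg.
  - by move=> x _; exact: integral_ge0.
  - by move=> x _; exact: integral_ge0.
  apply: filterS K2 => x Kx _.
  have s1 : sqint (kernel_law K x) (fun y : R => y - f x).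
    split; first exact: measurable_funB.
    apply/integrableP; split.
      by apply/measurable_EFinP; apply: measurable_funX; exact: measurable_funB.
    apply: le_lt_trans (ltry sig2); apply: le_trans Kx.
    rewrite le_eqVlt; apply/orP; left; apply/eqP; apply: eq_integral => y _.
    by rewrite /= ger0_norm ?sqr_ge0// real_normK ?num_real.
  (* The finite conditional second moment makes [y] integrable under [K x], so that [f x] is its
     genuine mean and not a value arising from a divergent integral. *)
  have yi : (kernel_law K x).-integrable setT (EFin \o (id : R -> R)).
    have := sqint_integrable (sqintD s1 (sqint_cst (kernel_law K x) (f x))).
    by apply: eq_integrable => // y _; rewrite /= subrK.
  have gxi : (kernel_law K x).-integrable setT (fun y => g (x, y)).
    have := integrableZl measurableT (h x) (sqint_integrable s1).
    by apply: eq_integrable => // y _; rewrite /g/= -EFinM mulrC.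
  have z0 : (\int[K x]_y g (x, y) = 0)%E.
    transitivity (Rintegral (kernel_law K x) setT (fun y => h x * (y - f x)))%:E.
      rewrite EFin_Rintegral.
        by apply: eq_integral => y _; rewrite /g/= mulrC.
      have := integrableZl measurableT (h x) (sqint_integrable s1).
      by apply: eq_integrable => // y _; rewrite /= -EFinM.
    rewrite RintegralZl//; last exact: sqint_integrable s1.
    rewrite RintegralB//; last exact: finite_measure_integrable_cst.
    by rewrite Rintegral_prob_cst subrr mulr0.
  have gxp := integrable_fin_num measurableT (integrable_funepos measurableT gxi).
  have gxn := integrable_fin_num measurableT (integrable_funeneg measurableT gxi).
  move: z0; rewrite integralE => /eqP; rewrite sube_eq.
  - rewrite add0e => /eqP H; rewrite -[RHS]/(\int[K x]_y (fun y => g^\- (x, y)) y)%E.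
    transitivity (\int[K x]_y (fun y => g (x, y))^\+ y)%E.
      by apply: eq_integral => y _; rewrite !funeposE.
    by rewrite H; apply: eq_integral => y _; rewrite !funenegE.
  - exact: gxp.
  - exact: fin_num_adde_defl.
rewrite E subee//; exact: integrable_fin_num gni.
Qed.

End regression_noise.

(** * Tail of the residual *)

Section residual_tail.
Context {R : realType} {d : measure_display} {X : measurableType d}.
Context {rho : probability (X * R)%type R} {mu : probability X R} {K : R.-pker X ~> R}.
Hypothesis rhoE : forall (A : set X) (B : set R), measurable A -> measurable B ->
  rho (A `*` B) = (\int[mu]_(x in A) K x B)%E.
Let f (x : X) : R := Rintegral (K x) setT id.
Context {sig2 B4 : R}.
Hypothesis sig20 : 0 < sig2.
Hypothesis B40 : 0 <= B4.
Hypothesis K2 : {ae mu, forall x, (\int[K x]_y (`|y - f x| ^+ 2)%:E <= sig2%:E)%E}.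
Hypothesis K4 : {ae mu, forall x, (\int[K x]_y (`|y - f x| ^+ 4)%:E <= B4%:E)%E}.
Context {e : nat -> X -> R}.
Hypothesis es : forall i, sqint mu (e i).
Hypothesis eo : forall i j, Rintegral mu setT (fun x => e i x * e j x) = (i == j)%:R.
Context {q : nat -> R} {G Qd : R}.
Hypothesis q0 : forall i, 0 < q i.
Hypothesis q1 : forall i, q i <= 1.
Hypothesis qG : {ae mu, forall x N, \sum_(i < N) q i * e i x ^+ 2 <= G}.
Hypothesis qQ : forall N, \sum_(i < N) q i <= Qd.
Context {bias : X -> R} {m : nat -> R} {Bb : R}.
Hypothesis bs : sqint mu bias.
Hypothesis bm : forall i, Rintegral mu setT (fun x => bias x * e i x) = m i.
Hypothesis bB : Rintegral mu setT (fun x => bias x ^+ 2) <= Bb.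

Let h i x := Num.sqrt (q i) * e i x.
Let eps (z : X * R) : R := z.2 - f z.1.
Let a i z := eps z * h i z.1.
Let b i (z : X * R) := bias z.1 * h i z.1 - Num.sqrt (q i) * m i.
Let S N x := \sum_(i < N) h i x ^+ 2.

Let hs i : sqint mu (h i). Proof. exact: sqintZ. Qed.

Let h2 i x : h i x ^+ 2 = q i * e i x ^+ 2.
Proof. by rewrite /h exprMn sqr_sqrtr// ltW. Qed.

Let h2_int i : Rintegral mu setT (fun x => h i x ^+ 2) = q i.
Proof.
under eq_Rintegral do rewrite h2.
rewrite RintegralZl//; last exact: sqint_integrable_sqr.
by under eq_Rintegral do rewrite expr2; rewrite eo eqxx mulr1.
Qed.

Let S_ge0 N x : 0 <= S N x.
Proof. by apply: sumr_ge0 => i _; exact: sqr_ge0. Qed.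

Let SG : {ae mu, forall x N, S N x <= G}.
Proof.
apply: filterS qG => x + N => /(_ N).
by rewrite /S; under [X in X <= _ -> _]eq_bigr do rewrite -h2.
Qed.

Let G0 : 0 <= G.
Proof.
have mu0 : (0 < mu setT)%E by rewrite probability_setT.
have [x] := @filter_ex _ _ (ae_properfilter_algebraOfSetsType mu0) _ qG.
by move=> /(_ 0%N); rewrite big_ord0.
Qed.

Let hG i : {ae mu, forall x, h i x ^+ 2 <= G}.
Proof.
apply: filterS SG => x /(_ i.+1); rewrite /S big_ord_recr/=.
by apply: le_trans; rewrite lerDr; exact: S_ge0.
Qed.

Let Si N : mu.-integrable setT (EFin \o S N).
Proof. by apply: integrable_sumR => i _; exact: sqint_integrable_sqr. Qed.

Let S_int N : Rintegral mu setT (S N) = \sum_(i < N) q i.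
Proof.
rewrite /S Rintegral_sum; last by move=> i _; exact: sqint_integrable_sqr.
by apply: eq_bigr => i _; rewrite h2_int.
Qed.

Let mS N : measurable_fun setT (S N).
Proof. by exact/measurable_EFinP/(measurable_int _ (Si N)). Qed.

Let GSi N : mu.-integrable setT (EFin \o (fun x => G * S N x)).
Proof.
have := integrableZl measurableT G (Si N).
by apply: eq_integrable => // x _; rewrite /= EFinM.
Qed.

Let S2i N : mu.-integrable setT (EFin \o (fun x => S N x ^+ 2)).
Proof.
apply: (@ae_le_integrable _ _ _ _ _ (fun x => G * S N x)) => //.
  exact: measurable_funX.
apply: filterS SG => x /(_ N) SN; rewrite ger0_norm ?sqr_ge0// expr2.
by apply: ler_wpM2r => //; exact: S_ge0.
Qed.

(** One factor [S N] is bounded by [G] almost everywhere, the other integrates to at most the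
    effective dimension. *)
Let S2_int N : Rintegral mu setT (fun x => S N x ^+ 2) <= G * Qd.
Proof.
apply: (@le_trans _ _ (Rintegral mu setT (fun x => G * S N x))).
  apply: ae_le_Rintegral => //.
  - by move=> x; exact: sqr_ge0.
  - by move=> x; rewrite mulr_ge0// S_ge0.
  apply: filterS SG => x /(_ N) SN; rewrite expr2.
  by apply: ler_wpM2r => //; exact: S_ge0.
by rewrite RintegralZl// S_int; apply: ler_wpM2l.
Qed.

Let as_ i : sqint rho (a i).
Proof. by have [] := noise_sqint rhoE (ltW sig20) K2 (hs i). Qed.

Let a_sum N z : \sum_(i < N) a i z ^+ 2 = `|eps z| ^+ 2 * S N z.1.
Proof.
rewrite /S mulr_sumr; apply: eq_bigr => i _.
by rewrite /a exprMn real_normK ?num_real.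
Qed.

Let a_sum2 N z : (\sum_(i < N) a i z ^+ 2) ^+ 2 = `|eps z| ^+ 4 * S N z.1 ^+ 2.
Proof. by rewrite a_sum exprMn -exprM. Qed.

Let A4 N := integrable_noise_pow rhoE B40 K4 (S2i N) (fun x => sqr_ge0 (S N x)).

Let As N : sqint rho (fun z => \sum_(i < N) a i z ^+ 2).
Proof.
split.
  by apply: measurable_sum => i; apply: measurable_funX; case: (as_ i).
by under eq_fun do rewrite a_sum2; case: (A4 N).
Qed.

Let A_int N : Rintegral rho setT (fun z => (\sum_(i < N) a i z ^+ 2) ^+ 2) <= B4 * (G * Qd).
Proof.
under eq_Rintegral do rewrite a_sum2.
by apply: le_trans (A4 N).2 _; apply: ler_wpM2l.
Qed.

(* With t = sum_j c_ij h_j the row sum is int a_i (eps t), and the noise bound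
   makes int (eps t)^2 at most sig2 times the row sum again. *)
Let cov_row N i : \sum_(j < N) (Rintegral rho setT (fun z => a i z * a j z)) ^+ 2 <=
  sig2 ^+ 2 * q i.
Proof.
pose c (j : nat) := Rintegral rho setT (fun z => a i z * a j z).
pose s := \sum_(j < N) c j ^+ 2.
pose t x := \sum_(j < N) (c j * Num.sqrt (q j)) * e j x.
have ts : sqint mu t by exact: (sqint_partial_sum es (fun j => c j * Num.sqrt (q j))).
have [ets ett] := noise_sqint rhoE (ltW sig20) K2 ts.
have t2 : Rintegral mu setT (fun x => t x ^+ 2) <= s.
  rewrite (Rintegral_partial_sum_sqr es eo (fun j => c j * Num.sqrt (q j))).
  apply: ler_sum => j _; rewrite exprMn sqr_sqrtr; last exact: ltW.
  by rewrite ler_piMr ?sqr_ge0.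
have [_ aii] := noise_sqint rhoE (ltW sig20) K2 (hs i).
have sE : s = Rintegral rho setT (fun z => a i z * (eps z * t z.1)).
  have E z : a i z * (eps z * t z.1) = \sum_(j < N) c j * (a i z * a j z).
    rewrite /t !mulr_sumr; apply: eq_bigr => j _; rewrite /a /h; ring.
  have ii j : rho.-integrable setT (EFin \o (fun z => a i z * a j z)).
    exact: sqint_mul.
  under eq_Rintegral do rewrite E.
  rewrite Rintegral_sum; last first.
    move=> j _; have := integrableZl measurableT (c j) (ii j).
    by apply: eq_integrable => // z _; rewrite /= EFinM.
  by apply: eq_bigr => j _; rewrite RintegralZl// expr2.
(* Young's inequality, weighted so that its second term is at most s / 2 and can be absorbed on the
   left. The weight divides by [sig2], hence the hypothesis [0 < sig2]. *)
have le : s <= Rintegral rho setT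
    (fun z => sig2 / 2 * a i z ^+ 2 + (2 * sig2)^-1 * (eps z * t z.1) ^+ 2).
  have i1 : rho.-integrable setT (EFin \o (fun z => sig2 / 2 * a i z ^+ 2)).
    have := integrableZl measurableT (sig2 / 2) (as_ i).2.
    by apply: eq_integrable => // z _; rewrite /= EFinM.
  have i2 : rho.-integrable setT (EFin \o (fun z => (2 * sig2)^-1 * (eps z * t z.1) ^+ 2)).
    have := integrableZl measurableT (2 * sig2)^-1 ets.2.
    by apply: eq_integrable => // z _; rewrite /= EFinM.
  rewrite {1}sE; apply: le_Rintegral => //.
  - exact: sqint_mul.
  - by have := integrableD measurableT i1 i2; apply: eq_integrable.
  move=> z _; move: (a i z) (eps z * t z.1) => u v.
  rewrite -subr_ge0 (_ : _ - _ = (2 * sig2)^-1 * (sig2 * u - v) ^+ 2); last first.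
    by field; rewrite gt_eqF.
  by rewrite mulr_ge0 ?sqr_ge0// invr_ge0 mulr_ge0// ltW.
rewrite RintegralD// in le; last 2 first.
- have := integrableZl measurableT (sig2 / 2) (as_ i).2.
  by apply: eq_integrable => // z _; rewrite /= EFinM.
- have := integrableZl measurableT (2 * sig2)^-1 ets.2.
  by apply: eq_integrable => // z _; rewrite /= EFinM.
rewrite !RintegralZl// in le; last 2 first.
- exact: ets.2.
- exact: (as_ i).2.
rewrite h2_int in aii.
have l1 : sig2 / 2 * Rintegral rho setT (fun z => a i z ^+ 2) <= sig2 / 2 * (sig2 * q i).
  by apply: ler_wpM2l => //; rewrite divr_ge0// ltW.
have l2 : (2 * sig2)^-1 * Rintegral rho setT (fun z => (eps z * t z.1) ^+ 2) <= s / 2.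
  apply: (@le_trans _ _ ((2 * sig2)^-1 * (sig2 * s))).
    apply: ler_wpM2l; first by rewrite invr_ge0 mulr_ge0// ltW.
    by apply: le_trans ett _; apply: ler_wpM2l => //; exact: ltW.
  by rewrite le_eqVlt; apply/orP; left; apply/eqP; field; rewrite gt_eqF.
rewrite -/s; move: le l1 l2; set u := Rintegral _ _ _; set v := Rintegral _ _ _ => le l1 l2.
by rewrite expr2; lra.
Qed.

Let bhs i : sqint mu (fun x => bias x * h i x).
Proof.
have mb : measurable_fun setT (fun x => bias x * h i x).
  by apply: measurable_funM; [case: bs|case: (hs i)].
split => //; apply: (@ae_le_integrable _ _ _ _ _ (fun x => G * bias x ^+ 2)).
- exact: measurable_funX.
- have := integrableZl measurableT G bs.2.
  by apply: eq_integrable => // z _; rewrite /= EFinM.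
apply: filterS (hG i) => x hx; rewrite ger0_norm ?sqr_ge0// exprMn mulrC.
by apply: ler_wpM2r => //; exact: sqr_ge0.
Qed.

Let bhm i : Rintegral rho setT (fun z => bias z.1 * h i z.1) = Num.sqrt (q i) * m i.
Proof.
rewrite (Rintegral_marginal rhoE (g := fun x => bias x * h i x)); last by case: (bhs i).
under eq_Rintegral do rewrite /h mulrCA.
by rewrite RintegralZl ?bm//; exact: sqint_mul.
Qed.

Let bss i : sqint rho (b i).
Proof.
apply: sqintB; last exact: sqint_cst.
exact: (sqint_marginal rhoE (bhs i)).
Qed.

Let b_centered i : Rintegral rho setT (b i) = 0.
Proof.
rewrite RintegralB//; last 2 first.
- exact: sqint_integrable (sqint_marginal rhoE (bhs i)).
- exact: finite_measure_integrable_cst.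
by rewrite Rintegral_prob_cst bhm subrr.
Qed.

(** Centring only lowers second moments, and summing over i before integrating produces bias^2 times
    [S N], with [S N] at most [G]. *)
Let b_sum N : \sum_(i < N) Rintegral rho setT (fun z => b i z ^+ 2) <= G * Bb.
Proof.
apply: (@le_trans _ _ (\sum_(i < N) Rintegral mu setT (fun x => (bias x * h i x) ^+ 2))).
  apply: ler_sum => i _.
  rewrite -(Rintegral_marginal rhoE (g := fun x => (bias x * h i x) ^+ 2)); last first.
    by apply: measurable_funX; case: (bhs i).
  apply: Rintegral_centered_sqr_le; last exact: bhm.
  exact: (sqint_marginal rhoE (bhs i)).
rewrite -Rintegral_sum; last by move=> i _; exact: (bhs i).2.
apply: (@le_trans _ _ (Rintegral mu setT (fun x => G * bias x ^+ 2))).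
  apply: ae_le_Rintegral.
  - by move=> x; apply: sumr_ge0 => i _; exact: sqr_ge0.
  - by move=> x; rewrite mulr_ge0// sqr_ge0.
  - by apply: integrable_sumR => i _; exact: (bhs i).2.
  - have := integrableZl measurableT G bs.2.
    by apply: eq_integrable => // z _; rewrite /= EFinM.
  apply: filterS SG => x /(_ N) SN.
  under eq_bigr do rewrite exprMn.
  by rewrite -mulr_sumr mulrC; apply: ler_wpM2r => //; exact: sqr_ge0.
rewrite RintegralZl; [exact: ler_wpM2l|exact: measurableT|exact: bs.2].
Qed.

Lemma residual_tail {dO} {O : measurableType dO} {Pr : probability O R} (n : nat)
    (Z : 'I_n -> O -> (X * R)%type) (w : R) (N : nat) :
  iid_sample Pr rho Z -> (0 < n)%N -> 0 < w -> sig2 * Qd <= w ->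
  (Pr [set o | (10 * w / n%:R < \sum_(i < N) (Num.sqrt (q i) *
     (n%:R^-1 * (\sum_(j < n) ((Z j o).2 - (f (Z j o).1 - bias (Z j o).1)) *
        e i (Z j o).1) - m i)) ^+ 2)%R]
   <= (B4 * (G * Qd) / (n%:R * w ^+ 2) + sig2 ^+ 2 * Qd / w ^+ 2 + G * Bb / w)%:E)%E.
Proof.
move=> ZP n0 w0 Qw.
have := iid_norm_tail ZP n0 w0 (a := fun i : 'I_N => a i) (b := fun i : 'I_N => b i).
move=> /(_ (B4 * (G * Qd)) (sig2 ^+ 2 * Qd) (G * Bb)) H.
have {H} := H (fun i => as_ i) _ (As N) (fun i => bss i) (fun i => b_centered i) _
  (A_int N) _ (b_sum N).
have a0 (i : 'I_N) : Rintegral rho setT (a i) = 0.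
  exact: (noise_centered rhoE (ltW sig20) K2 (hs i)).
move=> /(_ a0) H.
have {H} := H _ _.
have l1 : \sum_(i < N) Rintegral rho setT (fun z => a i z ^+ 2) <= w.
  apply: le_trans Qw; apply: (@le_trans _ _ (sig2 * \sum_(i < N) q i)).
    rewrite mulr_sumr; apply: ler_sum => i _.
    have [_] := noise_sqint rhoE (ltW sig20) K2 (hs i).
    by rewrite h2_int.
  by apply: ler_wpM2l => //; exact: ltW.
have l2 : \sum_(i < N) \sum_(j < N) (Rintegral rho setT (fun z => a i z * a j z)) ^+ 2 <=
    sig2 ^+ 2 * Qd.
  apply: (@le_trans _ _ (\sum_(i < N) sig2 ^+ 2 * q i)).
    by apply: ler_sum => i _; exact: cov_row.
  by rewrite -mulr_sumr; apply: ler_wpM2l => //; exact: sqr_ge0.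
move=> /(_ l1 l2).
have E o : \sum_(i < N) (n%:R^-1 * \sum_(j < n) (a i (Z j o) + b i (Z j o))) ^+ 2 =
  \sum_(i < N) (Num.sqrt (q i) *
     (n%:R^-1 * (\sum_(j < n) ((Z j o).2 - (f (Z j o).1 - bias (Z j o).1)) *
        e i (Z j o).1) - m i)) ^+ 2.
  apply: eq_bigr => i _; congr (_ ^+ 2).
  have -> : \sum_(j < n) (a i (Z j o) + b i (Z j o)) =
     Num.sqrt (q i) * (\sum_(j < n) ((Z j o).2 - (f (Z j o).1 - bias (Z j o).1)) *
        e i (Z j o).1) - n%:R * (Num.sqrt (q i) * m i).
    have -> : n%:R * (Num.sqrt (q i) * m i) = \sum_(j < n) Num.sqrt (q i) * m i.
      by rewrite sumr_const card_ord mulr_natl.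
    rewrite mulr_sumr -sumrB.
    by apply: eq_bigr => j _; rewrite /a /b /h /eps; ring.
  by field; rewrite pnatr_eq0 -lt0n.
by under eq_fun do rewrite E.
Qed.

End residual_tail.

(** * Asymptotics of real powers *)

Section powR_asymptotics.
Context {R : realType}.

Lemma powR_unbounded (k M : R) : 0 < k -> exists2 B0, 1 <= B0 &
  forall B, B0 <= B -> M <= B `^ k.
Proof.
move=> k0; exists (Num.max 1 (Num.max 1 M `^ k^-1)); first by rewrite le_max lexx.
move=> B; rewrite ge_max => /andP[B1 MB].
have m0 : 0 <= Num.max 1 M by rewrite le_max ler01.
apply: (@le_trans _ _ (Num.max 1 M)); first by rewrite le_max lexx orbT.
apply: (@le_trans _ _ ((Num.max 1 M `^ k^-1) `^ k)).
  by rewrite -powRrM mulVf ?gt_eqF// powRr1.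
by rewrite ge0_ler_powR ?nnegrE ?powR_ge0 ?(ltW k0)// (le_trans ler01).
Qed.

Lemma powRN_small (k eta : R) : 0 < k -> 0 < eta -> exists2 B0, 1 <= B0 &
  forall B, B0 <= B -> B `^ (- k) <= eta.
Proof.
move=> k0 e0; have [B0 B01 H] := powR_unbounded eta^-1 k0.
exists B0 => // B /H Be; rewrite powRN.
by rewrite -[leRHS]invrK lef_pV2// posrE ?invr_gt0// (lt_le_trans _ Be)// invr_gt0.
Qed.

Lemma half_le_ln (delta : R) : 0 < delta < 1 -> 2^-1 <= ln (2 / delta).
Proof.
move=> /andP[d0 d1].
have h2 : 2 <= 2 / delta by rewrite ler_pdivlMr//; nra.
apply: (@le_trans _ _ (ln 2)); last by rewrite ler_ln ?posrE// (lt_le_trans _ h2).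
have := expR_ge1Dx (- ln 2 : R); rewrite expRN lnK ?posrE//.
have -> : (2 : R)^-1 = 1 - 2^-1 by lra.
by move: (ln 2) => u; lra.
Qed.

(** Since [2 * ln (2 / delta)] is at least 1, the factor 2 in [C] lets the logarithm be inserted
    into a bound free of [delta]. *)
Lemma sqr_ge_of_ln (delta C T x y : R) : 0 < delta < 1 -> 0 < T ->
  0 <= x -> x ^+ 2 = y -> C = 2 * Num.sqrt T ->
  T * y <= (ln (2 / delta) * C * x) ^+ 2.
Proof.
move=> /half_le_ln h T0 x0 <- ->.
rewrite (_ : (_ * _ * _) ^+ 2 = (2 * ln (2 / delta)) ^+ 2 * (Num.sqrt T ^+ 2 * x ^+ 2)); last by ring.
rewrite (sqr_sqrtr (ltW T0)); apply: ler_peMl.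
  by apply: mulr_ge0; [exact: ltW|exact: sqr_ge0].
by move: (ln _) h => u h; nra.
Qed.

(** [P], [Gm], [Pa], [Ps] stand for the powers of [nu] with exponents 1/beta, g, a, s. The
    covariance term is controlled by 1/Gm through [P <= Gm], the bias term equals a multiple of Pa /
    (Ps Gm), and in the diagonal term [Ps <= c * n] trades 1/n for 1/Ps, which leaves the same
    ratio. *)
Lemma tail_sum_le (B4 A2 CQ c W n sig2 F3 P Gm Pa Ps : R) :
  0 < W -> 0 < n -> 0 < P -> 0 < Gm -> 0 < Pa -> 0 < Ps -> 0 < c ->
  0 <= B4 -> 0 <= A2 -> 0 <= CQ -> 0 <= F3 -> P <= Gm -> Ps <= c * n ->
  B4 * (A2 * Pa * (CQ * P)) / (n * (W * Gm) ^+ 2) +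
  sig2 ^+ 2 * (CQ * P) / (W * Gm) ^+ 2 + A2 * Pa * (F3 * Ps^-1) / (W * Gm) <=
  (B4 * A2 * CQ * c / W ^+ 2 + sig2 ^+ 2 * CQ / W ^+ 2 + A2 * F3 / W) *
  (Gm^-1 + Pa / (Ps * Gm)).
Proof.
move=> W0 n0 P0 G0 Pa0 Ps0 c0 B40 A20 CQ0 F30 PG Psn.
set u := Gm^-1; set v := Pa / (Ps * Gm).
have u0 : 0 < u by rewrite invr_gt0.
have v0 : 0 < v by rewrite divr_gt0// mulr_gt0.
set k1 := B4 * A2 * CQ * c / W ^+ 2; set k2 := sig2 ^+ 2 * CQ / W ^+ 2.
set k3 := A2 * F3 / W.
have k10 : 0 <= k1 by rewrite /k1 divr_ge0 ?sqr_ge0// !mulr_ge0// ltW.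
have k20 : 0 <= k2 by rewrite /k2 divr_ge0 ?sqr_ge0// mulr_ge0 ?sqr_ge0.
have k30 : 0 <= k3 by rewrite /k3 divr_ge0 ?mulr_ge0// ltW.
have t1 : B4 * (A2 * Pa * (CQ * P)) / (n * (W * Gm) ^+ 2) <= k1 * v.
  rewrite (_ : _ / _ = k1 * v * ((P / Gm) * (Ps / (c * n)))); last first.
    by rewrite /k1 /v; field; rewrite !gt_eqF.
  apply: ler_piMr; first by apply: mulr_ge0 => //; exact: ltW.
  have cn0 : 0 < c * n by exact: mulr_gt0.
  apply: mulr_ile1; [by apply: divr_ge0; exact: ltW|by apply: divr_ge0; exact: ltW| |].
  - by rewrite ler_pdivrMr ?mul1r.
  - by rewrite ler_pdivrMr ?mul1r.
have t2 : sig2 ^+ 2 * (CQ * P) / (W * Gm) ^+ 2 <= k2 * u.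
  rewrite (_ : _ / _ = k2 * u * (P / Gm)); last first.
    by rewrite /k2 /u; field; rewrite !gt_eqF.
  apply: ler_piMr; first by apply: mulr_ge0 => //; exact: ltW.
  by rewrite ler_pdivrMr ?mul1r.
have t3 : A2 * Pa * (F3 * Ps^-1) / (W * Gm) = k3 * v.
  by rewrite /k3 /v; field; rewrite !gt_eqF.
rewrite t3; nra.
Qed.

(** From ln n <= 2 r n^(1/(2r)) the denominator is at most (2r)^r n^(1/2), so the ratio grows at
    least like the square root of n. *)
Lemma log_ratio_unbounded (r M : R) : 1 < r -> exists N : nat, forall n, (N <= n)%N ->
  1 <= n%:R / ln n%:R `^ r :> R /\ n%:R / ln n%:R `^ r <= n%:R :> R /\
  M <= n%:R / ln n%:R `^ r.
Proof.
move=> r1; have r0 : 0 < r by exact: lt_trans r1.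
pose M' := Num.max 1 M * (2 * r) `^ r.
have half0 : 0 < 2^-1 :> R by rewrite invr_gt0.
have [B0 B01 H] := powR_unbounded M' half0.
(* From 4 on [ln n] is at least 1, because e <= 4; this keeps the ratio below n. *)
exists (maxn 4 (Num.truncn B0).+1) => n; rewrite geq_max => /andP[n4 nB].
have n0 : 0 < n%:R :> R by rewrite ltr0n; exact: leq_trans n4.
have Bn : B0 <= n%:R.
  by apply: ltW; apply: (lt_le_trans (truncnS_gt B0)); rewrite ler_nat.
have ln1 : 1 <= ln n%:R :> R.
  rewrite -ler_expR lnK ?posrE//; apply: (@le_trans _ _ (2 * 2)); last by rewrite -natrM ler_nat.
  have h : 2^-1 <= expR (- 2^-1) :> R by have := expR_ge1Dx (- 2^-1 : R); lra.
  have e2 : expR 2^-1 <= 2 :> R.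
    by rewrite -[leRHS]invrK -[leLHS]invrK -expRN lef_pV2 ?posrE ?expR_gt0// invr_gt0.
  have -> : expR 1 = expR 2^-1 * expR 2^-1 :> R by rewrite -expRD; congr expR; lra.
  by rewrite ler_pM// ltW// expR_gt0.
have lr1 : 1 <= ln n%:R `^ r :> R.
  have one_r : 1 `^ r = 1 :> R by rewrite powR1.
  by rewrite -[leLHS]one_r ge0_ler_powR ?nnegrE ?(ltW r0)// (le_trans ler01).
have l0 : 0 < ln n%:R `^ r :> R by exact: lt_le_trans lr1.
have tr : 0 < 2 * r by rewrite mulr_gt0.
have key : ln n%:R `^ r <= (2 * r) `^ r * n%:R `^ 2^-1 :> R.
  have h : ln n%:R <= 2 * r * n%:R `^ (2 * r)^-1 :> R.
    rewrite -ler_pdivrMl// /powR gt_eqF//.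
    by have := expR_ge1Dx ((2 * r)^-1 * ln n%:R : R); move: (_ * _) => u; lra.
  have -> : (n%:R : R) `^ 2^-1 = (n%:R `^ (2 * r)^-1) `^ r.
    by rewrite -powRrM; congr (_ `^ _); field; rewrite gt_eqF.
  rewrite -powRM ?powR_ge0 ?(ltW tr)//.
  rewrite ge0_ler_powR ?nnegrE ?(ltW r0)//; first exact: le_trans ln1.
  by rewrite mulr_ge0 ?powR_ge0// ltW.
have M0 : 1 <= Num.max 1 M by rewrite le_max lexx.
have ratio : Num.max 1 M <= n%:R / ln n%:R `^ r.
  rewrite ler_pdivlMr//.
  apply: (@le_trans _ _ (M' * n%:R `^ 2^-1)).
    by rewrite /M' -mulrA; apply: ler_wpM2l => //; exact: le_trans M0.
  have nn : n%:R `^ 2^-1 * n%:R `^ 2^-1 = n%:R :> R.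
    rewrite -powRD; last by rewrite (gt_eqF n0) implybT.
    have -> : 2^-1 + 2^-1 = 1 :> R by lra.
    by rewrite powRr1// ltW.
  by rewrite -[leRHS]nn; apply: ler_wpM2r; [exact: powR_ge0|exact: H].
split; [|split].
- exact: le_trans ratio.
- by rewrite ler_pdivrMr// ler_peMr// ltW.
- by apply: le_trans ratio; rewrite le_max lexx orbT.
Qed.

End powR_asymptotics.

(** * Rates for the spectral algorithm *)

Lemma measurable_compact_Rd (R : realType) (d : nat) (A : set 'rV[R]_d) :
  compact A -> measurable (A : set (Rd R d)).
Proof.
move=> cA; have : closed A by apply: compact_closed => //; exact: norm_hausdorff.
move=> /closed_openC oA; rewrite -[A]setCK; apply: measurableC.
exact: sub_sigma_algebra.
Qed.

Section spectral_algorithm.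
Context {R : realType} {d : nat} {Xs : set 'rV[R]_d}
    {rho : probability (Rd R d * R)%type R} {mu : probability (Rd R d) R}
    {K : R.-pker (Rd R d) ~> R} {k : 'rV[R]_d -> 'rV[R]_d -> R} {kappa : R}
    {lam : nat -> R} {e : nat -> Rd R d -> R}
    {beta s Rs sigma L tau E F : R} {phi : R -> R -> R}.
Hypothesis Xs_compact : compact Xs.
Hypothesis mu_Xs : mu (~` Xs) = 0%E.
Hypothesis rhoE : forall (A : set (Rd R d)) (B : set R), measurable A -> measurable B ->
     rho (A `*` B) = (\int[mu]_(x in A) K x B)%E.
Hypothesis k_le : forall x, Xs x -> k x x <= kappa ^+ 2.
Hypothesis merc : mercer_decomposition Xs mu k lam e.
Hypothesis beta1 : 1 < beta.
Hypothesis edr : EDR lam beta.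
Hypothesis filt : filter_function phi kappa E F tau.
Hypothesis s_tau : 0 < s <= 2 * tau.
Hypothesis src : in_interp_ball mu lam e s Rs (fstar K).
Hypothesis noise : noise_condition mu K sigma L.

Let lam0 i : 0 < lam i. Proof. by case: merc => + _ _ _ _ => /(_ i)[]. Qed.

Let es i : sqint mu (e i). Proof. by case: merc => _ me ei _ _; split. Qed.

Let eo i j : Rintegral mu setT (fun x => e i x * e j x) = (i == j)%:R.
Proof. by case: merc => _ _ _ + _; exact. Qed.

(** On [Xs] the diagonal Mercer sums increase to [k x x]; the complement of [Xs] is null. *)
Let ek : {ae mu, forall x N, \sum_(i < N) lam i * e i x ^+ 2 <= kappa ^+ 2}.
Proof.
exists (~` Xs); split => //; first by apply: measurableC; exact: measurable_compact_Rd.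
apply: subsetC => x Xx /= N; apply: le_trans (k_le Xx).
have [_ _ _ _ /(_ x x Xx Xx) kx] := merc.
have nd : nondecreasing_seq (fun N => \sum_(i < N) lam i * e i x * e i x).
  apply/nondecreasing_seqP => m; rewrite big_ord_recr/= lerDl -mulrA -expr2.
  by rewrite mulr_ge0 ?sqr_ge0// ltW.
rewrite -(cvg_lim _ kx)//.
under eq_bigr do rewrite expr2 mulrA.
exact: (nondecreasing_cvgn_le nd (cvgP _ kx)).
Qed.

Let lam_le i : 0 <= lam i <= kappa ^+ 2.
Proof. by rewrite (ltW (lam0 i))/= (eigenvalue_le es eo lam0 ek). Qed.

Let fs i := L2coef mu (fstar K) (e i).

Lemma source_coefficients : exists a : nat -> R,
  [/\ sqint mu (fstar K),
   (fun N => Rintegral mu setT (fun x => (fstar K x - \sum_(i < N) fs i * e i x) ^+ 2))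
     @ \oo --> (0 : R),
   forall i, fs i = a i * lam i `^ (s / 2) &
   forall N, \sum_(i < N) a i ^+ 2 <= Rs ^+ 2].
Proof.
have [a [aR cv]] := src.
have [fsq cvR fsE] := L2_expansion es eo (b := fun i => a i * lam i `^ (s / 2))
  (measurable_regression (K := K)) cv.
exists a; split => //.
- under eq_fun => N.
    under eq_Rintegral => x _.
      under eq_bigr do rewrite /fs /L2coef fsE.
      over.
    over.
  exact: cvR.
- move=> N; rewrite -lee_fin; apply: le_trans aR.
  rewrite -sumEFin -(big_mkord predT (fun i => (a i ^+ 2)%:E)).
  by apply: nneseries_lim_ge => i _ _; rewrite lee_fin sqr_ge0.
Qed.

(** * Bias and leverage for a fixed regularization parameter *)

Section fixed_regularization.
Context {nu : R}.
Hypothesis nu0 : 0 < nu.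

Let c i := phi nu (lam i) * fs i.

Let f_nuE : f_nu phi lam e fs nu =
  (fun x => limn (fun N => \sum_(i < N) c i * lam i * e i x)).
Proof.
apply/funext => x; rewrite /f_nu; congr (limn _); apply/funext => N; apply: eq_bigr => i _.
by rewrite /c; ring.
Qed.

(** The filter bound with exponent 0 gives phi <= E nu. The dependence on [nu] is harmless, as the
    sum only has to be finite for the series of [f_nu] to converge. *)
Lemma filter_sum_bounded : exists S, forall N, \sum_(i < N) c i ^+ 2 <= S.
Proof.
have [a [_ _ fsE aR]] := source_coefficients.
have [_ phi0 phiE _] := filt.
pose Q := (kappa ^+ 2) `^ (s / 2).
exists ((E * nu) ^+ 2 * (Rs ^+ 2 * Q ^+ 2)) => N.
apply: (@le_trans _ _ (\sum_(i < N) (E * nu) ^+ 2 * (a i ^+ 2 * Q ^+ 2))).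
  apply: ler_sum => i _; rewrite /c exprMn fsE exprMn.
  have p0 := phi0 nu (lam i) nu0 (lam_le i).
  have := phiE nu 0 (lam i) nu0; rewrite lexx ler01 => /(_ isT (lam_le i)).
  rewrite powRr0 mul1r subr0 powRr1 ?(ltW nu0)// => pE.
  apply: ler_pM; [exact: sqr_ge0|by apply: mulr_ge0; exact: sqr_ge0| |].
    by rewrite lerXn2r ?nnegrE// (le_trans p0).
  apply: ler_wpM2l; first exact: sqr_ge0.
  rewrite lerXn2r ?nnegrE ?powR_ge0//.
  have [s0 _] := andP s_tau; have /andP[l0 lk] := lam_le i.
  by rewrite ge0_ler_powR ?nnegrE ?sqr_ge0// divr_ge0// ltW.
rewrite -mulr_sumr -mulr_suml; apply: ler_wpM2l; first exact: sqr_ge0.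
by apply: ler_wpM2r; [exact: sqr_ge0|exact: aR].
Qed.

Let bias x := fstar K x - f_nu phi lam e fs nu x.

Lemma sqint_bias : sqint mu bias.
Proof.
have [a [fsq _ _ _]] := source_coefficients.
have [S cS] := filter_sum_bounded.
apply: sqintB => //.
by rewrite f_nuE; exact: (sqint_filtered_series es eo lam0 ek cS).
Qed.

Lemma measurable_f_nu : measurable_fun setT (f_nu phi lam e fs nu).
Proof.
have [S cS] := filter_sum_bounded.
rewrite f_nuE; exact: measurable_filtered_series.
Qed.

Lemma bias_coef i :
  Rintegral mu setT (fun x => bias x * e i x) = (1 - lam i * phi nu (lam i)) * fs i.
Proof.
have [a [fsq _ _ _]] := source_coefficients.
have [S cS] := filter_sum_bounded.
rewrite /bias f_nuE; under eq_Rintegral do rewrite mulrBl.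
have vs := sqint_filtered_series es eo lam0 ek cS.
rewrite RintegralB//; [|exact: sqint_mul|exact: sqint_mul].
rewrite (filtered_series_coef es eo lam0 ek cS) -/(L2coef _ _ _) -/(fs i) /c.
by ring.
Qed.

(** The qualification is applied with exponent s/2, the power of [lam i] supplied by the source
    condition; this is where [s <= 2 * tau] enters. *)
Lemma bias_sqnorm : Rintegral mu setT (fun x => bias x ^+ 2) <=
  3 * (F ^+ 2 * Rs ^+ 2 * nu `^ (- s)).
Proof.
have [a [fsq cv fsE aR]] := source_coefficients.
have [S cS] := filter_sum_bounded.
have [tau1 _ _ phiF] := filt.
rewrite /bias f_nuE.
apply: (filtered_series_bias es eo lam0 ek cS fsq cv) => N.
apply: (@le_trans _ _ (\sum_(i < N) F ^+ 2 * nu `^ (- s) * a i ^+ 2)).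
  apply: ler_sum => i _.
  have -> : fs i - c i * lam i = (1 - lam i * phi nu (lam i)) * lam i `^ (s / 2) * a i.
    by rewrite /c fsE; ring.
  rewrite exprMn; apply: ler_wpM2r; first exact: sqr_ge0.
  have s2 : 0 <= s / 2 <= tau.
    by have /andP[s0 st] := s_tau; rewrite ler_pdivrMr// [_ * 2]mulrC st andbT divr_ge0// ltW.
  have h := phiF nu (s / 2) (lam i) nu0 s2 (lam_le i).
  have -> : nu `^ (- s) = (nu `^ (- (s / 2))) ^+ 2.
    rewrite -powR_mulrn ?powR_ge0// -powRrM; congr (_ `^ _); lra.
  rewrite -exprMn -[leLHS]real_normK ?num_real// lerXn2r ?nnegrE//.
    by rewrite (le_trans _ h)// mulr_ge0// powR_ge0.
  by rewrite normrM [X in _ * X]ger0_norm ?powR_ge0.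
rewrite -mulr_sumr [leRHS]mulrAC; apply: ler_wpM2l.
  by rewrite mulr_ge0 ?sqr_ge0// powR_ge0.
exact: aR.
Qed.

Context {a A C : R}.
Hypothesis a01 : 0 <= a <= 1.
Hypothesis Ma : {ae mu, forall x,
    (\sum_(i <oo) ((lam i `^ a * (e i x) ^+ 2)%:E) <= (A ^+ 2)%:E)%E}.
Hypothesis lamC : forall i, lam i <= C * i.+1%:R `^ (- beta).
Hypothesis nu1 : 1 <= nu.

Let q i := lam i / (lam i + nu^-1).

Lemma leverage_bound : {ae mu, forall x N,
  \sum_(i < N) q i * e i x ^+ 2 <= A ^+ 2 * nu `^ a}.
Proof.
apply: filterS Ma => x Mx N.
have : \sum_(i < N) lam i `^ a * e i x ^+ 2 <= A ^+ 2.
  rewrite -lee_fin; apply: le_trans Mx.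
  rewrite -sumEFin -(big_mkord predT (fun i => (lam i `^ a * e i x ^+ 2)%:E)).
  by apply: nneseries_lim_ge => i _ _; rewrite lee_fin mulr_ge0 ?sqr_ge0 ?powR_ge0.
move=> h; apply: (@le_trans _ _ (nu `^ a * \sum_(i < N) lam i `^ a * e i x ^+ 2)).
  rewrite mulr_sumr; apply: ler_sum => i _; rewrite mulrA.
  apply: ler_wpM2r; first exact: sqr_ge0.
  apply: le_trans (le_ratio_powR (lam0 i) nu0 a01) _.
  by rewrite powRM ?(ltW (lam0 i)) ?(ltW nu0)// mulrC.
by rewrite mulrC; apply: ler_wpM2r => //; exact: powR_ge0.
Qed.

Lemma measurable_resid_coord {dO} {O : measurableType dO} {Pr : probability O R}
    (n : nat) (Z : 'I_n -> O -> (Rd R d * R)%type) (i : nat) :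
  iid_sample Pr rho Z ->
  measurable_fun setT (fun o => resid_coord phi lam e fs nu (fun j => Z j o) i).
Proof.
move=> [mZ _]; have mf := measurable_f_nu.
rewrite /resid_coord; apply: measurable_funM => //; apply: measurable_funB => //.
apply: measurable_funM => //; apply: measurable_sum => j.
have mZ1 : measurable_fun setT (fun o => (Z j o).1) by exact: measurableT_comp.
have mZ2 : measurable_fun setT (fun o => (Z j o).2) by exact: measurableT_comp.
apply: measurable_funM.
  by apply: measurable_funB => //; exact: measurableT_comp mf mZ1.
by case: (es i) => me _; exact: measurableT_comp me mZ1.
Qed.

Lemma resid_coord_tail {dO} {O : measurableType dO} {Pr : probability O R}
    (n : nat) (Z : 'I_n -> O -> (Rd R d * R)%type) (w : R) (N : nat) :
  let sig2 := sigma ^+ 2 + 1 in let B4 := 12 * sigma ^+ 2 * L ^+ 2 in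
  let Qd := (2 + C / (beta - 1)) * nu `^ beta^-1 in
  iid_sample Pr rho Z -> (0 < n)%N -> 0 < w -> sig2 * Qd <= w ->
  (Pr [set o | (10 * w / n%:R <
     \sum_(i < N) (resid_coord phi lam e fs nu (fun j => Z j o) i) ^+ 2)%R]
   <= (B4 * (A ^+ 2 * nu `^ a * Qd) / (n%:R * w ^+ 2) + sig2 ^+ 2 * Qd / w ^+ 2 +
       A ^+ 2 * nu `^ a * (3 * (F ^+ 2 * Rs ^+ 2 * nu `^ (- s))) / w)%:E)%E.
Proof.
move=> sig2 B4 Qd ZP n0 w0 Qw.
(* [sigma] may be 0, so 1 is added to make the variance bound positive. In [B4] the 12 is 4!/2, from
   the noise condition at m = 4. *)
have sig20 : 0 < sig2 by rewrite /sig2 ltr_wpDl// sqr_ge0.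
have B40 : 0 <= B4 by rewrite /B4 mulr_ge0 ?sqr_ge0// mulr_ge0 ?sqr_ge0.
have K2 : {ae mu, forall x, (\int[K x]_y (`|y - fstar K x| ^+ 2)%:E <= sig2%:E)%E}.
  apply: filterS noise => x /(_ 2%N isT) /le_trans; apply.
  by rewrite lee_fin subnn expr0 mulr1 mulVf// mul1r lerDl.
have K4 : {ae mu, forall x, (\int[K x]_y (`|y - fstar K x| ^+ 4)%:E <= B4%:E)%E}.
  apply: filterS noise => x /(_ 4%N isT) /le_trans; apply.
  rewrite lee_fin /B4 (_ : (4 `!)%:R = 24 :> R)//.
  by rewrite (_ : 2^-1 * 24 = 12 :> R)//; lra.
have q0 i : 0 < q i by rewrite /q divr_gt0// addr_gt0// invr_gt0.
have q1 i : q i <= 1.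
  by rewrite /q ler_pdivrMr ?mul1r ?addr_gt0 ?invr_gt0// lerDl invr_ge0 ltW.
have qQ M : \sum_(i < M) q i <= Qd by exact: effective_dimension_bound.
have := residual_tail rhoE sig20 B40 K2 K4 es eo q0 q1 leverage_bound qQ
  sqint_bias bias_coef bias_sqnorm N ZP n0 w0 Qw.
rewrite (_ : [set o | _] = [set o | (10 * w / n%:R <
     \sum_(i < N) (resid_coord phi lam e fs nu (fun j => Z j o) i) ^+ 2)%R])//.
apply/funext => o; congr (_ < _); apply: eq_bigr => i _; congr (_ ^+ 2).
rewrite /resid_coord; congr (_ * (_ * _ - _)); apply: eq_bigr => j _.
by rewrite /bias /fstar; ring.
Qed.

End fixed_regularization.

(* The base [B n] is [n] in part (i) and [n / ln^r n] in part (ii). *)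
Lemma residual_rate (a g kp c1 c2 : R) (B nu : nat -> R) (N0 : nat) :
  0 <= a <= 1 -> M_finite mu lam e a -> 0 < g -> beta^-1 <= g -> a < s + g ->
  0 < kp -> kp * s <= 1 -> 0 < c1 -> 0 < c2 ->
  (forall n, (N0 <= n)%N -> c1 * B n `^ kp <= nu n <= c2 * B n `^ kp) ->
  (forall M : R, exists N, forall n, (N <= n)%N ->
     1 <= B n /\ B n <= n%:R /\ M <= B n) ->
  exists C : R, 0 < C /\
   forall delta : R, 0 < delta < 1 ->
   exists N : nat, forall n : nat, (N <= n)%N ->
   forall (dO : measure_display) (O : measurableType dO) (Pr : probability O R)
          (Z : 'I_n -> O -> (Rd R d * R)%type),
     iid_sample Pr rho Z ->
     ((1 - delta)%:E <= Pr [set w | (resid_sqnorm phi lam e fs (nu n) (fun j => Z j w)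
         <= ((ln (2 / delta) * C * nu n `^ (g / 2) / Num.sqrt n%:R) ^+ 2)%:E)%E])%E
     /\
     ((1 - delta)%:E <= Pr [set w | (resid_sqnorm phi lam e fs (nu n) (fun j => Z j w)
         <= ((ln (2 / delta) * C * B n `^ (- (2^-1 * (1 - g * kp)))) ^+ 2)%:E)%E])%E.
Proof.
move=> a01 [A Ma] g0 bg asg kp0 kps c10 c20 nuB Blim.
have [c0 [C [_ C0 lamC]]] := edr.
have {c0} {}lamC i : lam i <= C * i.+1%:R `^ (- beta) by case/andP: (lamC i).
have [s0 _] := andP s_tau.
pose sig2 := sigma ^+ 2 + 1; pose B4 := 12 * sigma ^+ 2 * L ^+ 2.
have sig20 : 0 < sig2 by rewrite /sig2 ltr_wpDl// sqr_ge0.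
have B40 : 0 <= B4 by rewrite /B4 mulr_ge0 ?sqr_ge0// mulr_ge0 ?sqr_ge0.
pose CQ := 2 + C / (beta - 1).
have CQ0 : 0 < CQ by rewrite /CQ ltr_wpDr// divr_ge0 ?(ltW C0)// subr_ge0 ltW.
(* The smallest multiple for which the available bound on the trace, [sig2 * CQ * P], stays below
   [W * Gm] whenever [P <= Gm]. *)
pose W := sig2 * CQ.
have W0 : 0 < W by exact: mulr_gt0.
pose F3 := 3 * (F ^+ 2 * Rs ^+ 2).
have F30 : 0 <= F3 by rewrite /F3 mulr_ge0// mulr_ge0 ?sqr_ge0.
pose c := c2 `^ s.
have cp : 0 < c by exact: powR_gt0.
pose C1 := B4 * A ^+ 2 * CQ * c / W ^+ 2 + sig2 ^+ 2 * CQ / W ^+ 2 + A ^+ 2 * F3 / W.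
have C10 : 0 <= C1.
  rewrite /C1; apply: addr_ge0; first apply: addr_ge0.
  - by rewrite divr_ge0 ?sqr_ge0// mulr_ge0 ?(ltW cp)// mulr_ge0 ?(ltW CQ0)// mulr_ge0 ?sqr_ge0.
  - by rewrite divr_ge0 ?sqr_ge0// mulr_ge0 ?sqr_ge0// ltW.
  - by rewrite divr_ge0 ?(ltW W0)// mulr_ge0 ?sqr_ge0.
(* In the last factor the 1 serves the bound in terms of [nu n] and [c2 ^ g] the bound in terms of
   [B n], so that one constant works for both. *)
pose T := 10 * W * (1 + c2 `^ g).
have T0 : 0 < T by rewrite /T !mulr_gt0// ltr_wpDr// powR_ge0.
exists (2 * Num.sqrt T); split; first by rewrite mulr_gt0// sqrtr_gt0.
move=> delta dlt; have [d0 d1] := andP dlt.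
(* Each of the two decaying powers of [nu n] in the tail bound gets half of delta / (C1 + 1); the 1
   keeps the denominator positive from [0 <= C1]. *)
have eta0 : 0 < delta / (2 * (C1 + 1)) by rewrite divr_gt0// mulr_gt0// ltr_wpDl.
have sga0 : 0 < s + g - a by rewrite subr_gt0.
have [X1 X11 HX1] := powRN_small g0 eta0.
have [X2 X21 HX2] := powRN_small sga0 eta0.
have [Y Y1 HY] := powR_unbounded (Num.max X1 X2 / c1) kp0.
have [N1 HN1] := Blim Y.
exists (maxn 1 (maxn N0 N1)) => n; rewrite !geq_max => /and3P[n0 nN0 nN1] dO O Pr Z ZP.
have [B1 [Bn YB]] := HN1 n nN1.
have /andP[nuB1 nuB2] := nuB n nN0.
have nR : 0 < n%:R :> R by rewrite ltr0n.
have Bp : 0 < B n by exact: lt_le_trans B1.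
have Xnu : Num.max X1 X2 <= nu n.
  apply: le_trans nuB1; rewrite mulrC -ler_pdivrMr//; exact: HY.
have X1nu : X1 <= nu n by apply: le_trans Xnu; rewrite le_max lexx.
have X2nu : X2 <= nu n by apply: le_trans Xnu; rewrite le_max lexx orbT.
have nu1 : 1 <= nu n by exact: le_trans X1nu.
have nu0 : 0 < nu n by exact: lt_le_trans nu1.
have nuge0 := ltW nu0.
pose Gm := nu n `^ g; pose P := nu n `^ beta^-1; pose Pa := nu n `^ a; pose Ps := nu n `^ s.
have PG : P <= Gm by apply: ler_powR.
have Gm0 : 0 < Gm by exact: powR_gt0.
(* Because [kp * s <= 1] and [B n >= 1], the power kp s of [B n] is at most [B n], hence at most
   n. *)
have Psn : Ps <= c * n%:R.
  apply: (@le_trans _ _ ((c2 * B n `^ kp) `^ s)).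
    by apply: ge0_ler_powR; rewrite ?nnegrE ?(ltW s0)// mulr_ge0 ?powR_ge0// ltW.
  rewrite powRM ?powR_ge0 ?(ltW c20)// -powRrM; apply: ler_wpM2l; first exact: powR_ge0.
  apply: le_trans Bn; rewrite -[leRHS]powRr1 ?(ltW Bp)//; exact: ler_powR.
pose w := W * Gm.
have w0 : 0 < w by exact: mulr_gt0.
have Qw : sig2 * (CQ * P) <= w.
  by rewrite mulrA; apply: ler_wpM2l => //; exact: ltW.
have vE : nu n `^ (- (s + g - a)) = Pa / (Ps * Gm).
  rewrite /Pa /Ps /Gm -powRD; last by rewrite (gt_eqF nu0) implybT.
  rewrite -powRN -powRD; last by rewrite (gt_eqF nu0) implybT.
  by congr (_ `^ _); ring.
have tail M : (Pr [set o | (10 * w / n%:R <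
     \sum_(i < M) (resid_coord phi lam e fs (nu n) (fun j => Z j o) i) ^+ 2)%R]
     <= delta%:E)%E.
  have := resid_coord_tail nu0 a01 Ma lamC nu1 M ZP n0 w0 Qw.
  move=> /le_trans; apply; rewrite lee_fin.
  have := @tail_sum_le _ B4 (A ^+ 2) CQ c W n%:R sig2 F3 P Gm Pa Ps
    W0 nR (powR_gt0 beta^-1 nu0) Gm0 (powR_gt0 a nu0) (powR_gt0 s nu0) cp B40
    (sqr_ge0 A) (ltW CQ0) F30 PG Psn.
  have GmE : Gm^-1 = nu n `^ (- g) by rewrite powRN.
  have PsE : Ps^-1 = nu n `^ (- s) by rewrite powRN.
  rewrite -/C1 -vE GmE PsE => h.
  have h1 : nu n `^ (- g) + nu n `^ (- (s + g - a)) <= delta / (C1 + 1).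
    rewrite (_ : delta / (C1 + 1) = delta / (2 * (C1 + 1)) + delta / (2 * (C1 + 1))).
      by apply: lerD; [exact: HX1|exact: HX2].
    by field; rewrite gt_eqF// ltr_wpDl.
  have h2 : C1 * (nu n `^ (- g) + nu n `^ (- (s + g - a))) <= delta.
    apply: (@le_trans _ _ (C1 * (delta / (C1 + 1)))); first exact: ler_wpM2l.
    rewrite mulrA ler_pdivrMr ?ltr_wpDl// mulrC; apply: ler_wpM2l; first exact: ltW.
    by rewrite lerDl.
  apply: le_trans h2; apply: le_trans h.
  rewrite le_eqVlt; apply/orP; left; apply/eqP.
  by rewrite /F3 /w /P /Pa /sig2 /B4 /CQ !mulrA.
have mr i : measurable_fun setT
    (fun o => resid_coord phi lam e fs (nu n) (fun j => Z j o) i).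
  exact: (measurable_resid_coord nu0 i ZP).
have wT : 10 * w / n%:R <= T * (Gm / n%:R).
  rewrite /T /w (_ : 10 * (W * Gm) / n%:R = 10 * W * (Gm / n%:R)); last by ring.
  apply: ler_wpM2r; first by rewrite divr_ge0 ?ltW.
  by rewrite ler_peMr ?lerDl ?powR_ge0// mulr_ge0// ltW.
have Gn0 : 0 <= Gm / n%:R by rewrite divr_ge0// ltW.
split.
  apply: (nneseries_tail mr _ tail); apply: le_trans wT _.
  rewrite -[X in _ <= X ^+ 2]mulrA; apply: sqr_ge_of_ln => //.
    by rewrite divr_ge0 ?powR_ge0 ?sqrtr_ge0.
  rewrite exprMn exprVn sqr_sqrtr ?(ltW nR)//; congr (_ / _).
  rewrite -powR_mulrn ?powR_ge0// -powRrM; congr (_ `^ _); lra.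
apply: (nneseries_tail mr _ tail).
apply: (@le_trans _ _ (T * B n `^ (- (1 - g * kp)))); last first.
  apply: sqr_ge_of_ln => //; first exact: powR_ge0.
  rewrite -powR_mulrn ?powR_ge0// -powRrM; congr (_ `^ _); lra.
have GB : Gm / n%:R <= c2 `^ g * B n `^ (- (1 - g * kp)).
  apply: (@le_trans _ _ ((c2 * B n `^ kp) `^ g / n%:R)).
    apply: ler_wpM2r; first by rewrite invr_ge0 ltW.
    by apply: ge0_ler_powR; rewrite ?nnegrE ?(ltW g0)// mulr_ge0 ?powR_ge0// ltW.
  rewrite powRM ?powR_ge0 ?(ltW c20)// -powRrM -mulrA; apply: ler_wpM2l; first exact: powR_ge0.
  rewrite (_ : - (1 - g * kp) = kp * g + - 1); last by ring.
  rewrite powRD; last by rewrite (gt_eqF Bp) implybT.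
  apply: ler_wpM2l; first exact: powR_ge0.
  by rewrite powRN powRr1 ?(ltW Bp)// lef_pV2// posrE.
rewrite /w (_ : 10 * (W * Gm) / n%:R = 10 * W * (Gm / n%:R)); last by ring.
rewrite /T -[leRHS]mulrA; apply: ler_wpM2l; first by rewrite mulr_ge0// ltW.
apply: le_trans GB _; rewrite mulrDl mul1r lerDr; exact: powR_ge0.
Qed.

End spectral_algorithm.

(** * The two regimes of the theorem *)

Unset Implicit Arguments.

Theorem theorem15 (R : realType) (d : nat) (Xs : set 'rV[R]_d)
    (rho : probability (Rd R d * R)%type R) (mu : probability (Rd R d) R)
    (K : R.-pker (Rd R d) ~> R) (k : 'rV[R]_d -> 'rV[R]_d -> R) (kappa : R)
    (lam : nat -> R) (e : nat -> Rd R d -> R)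
    (beta alpha0 s Rs sigma L tau E F : R) (phi : R -> R -> R) :
  (* X compact, rho supported on X x R, marginal mu, conditional law K *)
  compact Xs ->
  mu (~` Xs) = 0%E ->
  (forall (A : set (Rd R d)) (B : set R), measurable A -> measurable B ->
     rho (A `*` B) = (\int[mu]_(x in A) K x B)%E) ->
  rho.-integrable setT (fun z => (z.2 ^+ 2)%:E) ->
  (* continuous bounded kernel and its spectral data *)
  {within Xs `*` Xs, continuous (fun p => k p.1 p.2)} ->
  0 < kappa -> (forall x, Xs x -> k x x <= kappa ^+ 2) ->
  mercer_decomposition Xs mu k lam e ->
  (* (EDR), embedding index *)
  1 < beta -> EDR lam beta ->
  alpha0 = embedding_index mu lam e beta -> beta^-1 <= alpha0 < 1 ->
  (* filter function with qualification tau *)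
  filter_function phi kappa E F tau ->
  (* (Source) *)
  0 < s <= 2 * tau -> in_interp_ball mu lam e s Rs (fstar K) ->
  (* (Noise) *)
  noise_condition mu K sigma L ->
  let fs := fun i => L2coef mu (fstar K) (e i) in
  (* (i) *)
  (alpha0 < s + beta^-1 ->
   forall nu : nat -> R,
     (exists c1 c2 : R, [/\ 0 < c1, 0 < c2 & forall n : nat, (1 <= n)%N ->
        c1 * n%:R `^ (beta / (s * beta + 1)) <= nu n
        <= c2 * n%:R `^ (beta / (s * beta + 1))]) ->
   exists C : R, 0 < C /\
   forall delta : R, 0 < delta < 1 ->
   exists N : nat, forall n : nat, (N <= n)%N ->
   forall (dO : measure_display) (O : measurableType dO) (Pr : probability O R)
          (Z : 'I_n -> O -> (Rd R d * R)%type),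
     iid_sample Pr rho Z ->
     ((1 - delta)%:E <= Pr [set w | (resid_sqnorm phi lam e fs (nu n) (fun j => Z j w)
         <= ((ln (2 / delta) * C * nu n `^ ((2 * beta)^-1) / Num.sqrt n%:R) ^+ 2)%:E)%E])%E
     /\
     ((1 - delta)%:E <= Pr [set w | (resid_sqnorm phi lam e fs (nu n) (fun j => Z j w)
         <= ((ln (2 / delta) * C * n%:R `^ (- (2^-1 * (s * beta / (s * beta + 1)))))
               ^+ 2)%:E)%E])%E)
  /\
  (* (ii) *)
  (s + beta^-1 <= alpha0 ->
   forall alpha r : R, alpha0 < alpha <= 1 -> 1 < r ->
   forall nu : nat -> R,
     (exists c1 c2 : R, [/\ 0 < c1, 0 < c2 & forall n : nat, (2 <= n)%N ->
        c1 * (n%:R / ln n%:R `^ r) `^ alpha^-1 <= nu n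
        <= c2 * (n%:R / ln n%:R `^ r) `^ alpha^-1]) ->
   exists C : R, 0 < C /\
   forall delta : R, 0 < delta < 1 ->
   exists N : nat, forall n : nat, (N <= n)%N ->
   forall (dO : measure_display) (O : measurableType dO) (Pr : probability O R)
          (Z : 'I_n -> O -> (Rd R d * R)%type),
     iid_sample Pr rho Z ->
     ((1 - delta)%:E <= Pr [set w | (resid_sqnorm phi lam e fs (nu n) (fun j => Z j w)
         <= ((ln (2 / delta) * C * nu n `^ ((alpha - s) / 2) / Num.sqrt n%:R) ^+ 2)%:E)%E])%E
     /\
     ((1 - delta)%:E <= Pr [set w | (resid_sqnorm phi lam e fs (nu n) (fun j => Z j w)
         <= ((ln (2 / delta) * C * (n%:R / ln n%:R `^ r) `^ (- (2^-1 * (s / alpha))))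
               ^+ 2)%:E)%E])%E).
Proof.
move=> cX muX rhoE _ _ _ kle merc beta1 edr alpha0E /andP[ba0 _] filt s_tau src noise fs.
have beta0 : 0 < beta by exact: lt_trans beta1.
have [s0 _] := andP s_tau.
have sb0 : 0 < s * beta + 1 by rewrite ltr_wpDl// mulr_ge0// ltW.
pose D := [set a : R | beta^-1 <= a <= 1 /\ M_finite mu lam e a].
(* The infimum [alpha0] need not be attained, so the embedding is used at an exponent strictly below
   a given [x > alpha0]. *)
have index_lt x : alpha0 < x -> exists2 a, D a & a < x.
  move=> ax; have hi : has_inf D.
    split; last by exists beta^-1 => a /= [/andP[]].
    (* The infimum of the empty set is 0 by convention, which [beta^-1 <= alpha0] excludes. *)
    apply/set0P/negP => /eqP DE; move: ba0; rewrite alpha0E /embedding_index -/D DE inf0.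
    by rewrite leNgt invr_gt0 beta0.
  have [a Da] := inf_adherent (eps := x - alpha0) (ltac:(by rewrite subr_gt0)) hi.
  by rewrite -[inf D]/(embedding_index mu lam e beta) -alpha0E subrKC => ?; exists a.
have rate := residual_rate cX muX rhoE kle merc beta1 edr filt s_tau src noise.
split=> [as_ nu [c1 [c2 [c10 c20 nuB]]]|sa alpha r /andP[a0a a1] r1 nu [c1 [c2 [c10 c20 nuB]]]].
(* Here g = 1/beta: the trace alone dictates the rate, and [a < s + g] is the assumption of part (i)
   passed to a nearby exponent. *)
- have [a [/andP[ba a_le1] Ma] a_lt] := index_lt _ as_.
  have a01 : 0 <= a <= 1 by rewrite a_le1 andbT (le_trans _ ba)// invr_ge0 ltW.
  have kp0 : 0 < beta / (s * beta + 1) by rewrite divr_gt0.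
  have g0 : 0 < beta^-1 by rewrite invr_gt0.
  have kps : beta / (s * beta + 1) * s <= 1.
    by rewrite mulrAC ler_pdivrMr// mul1r mulrC lerDl.
  have [|C [C0 H]] := rate a beta^-1 (beta / (s * beta + 1)) c1 c2
      (fun n => n%:R) nu 1 a01 Ma g0 (lexx _) a_lt kp0 kps c10 c20 nuB.
    move=> M; exists (maxn 1 (Num.truncn M).+1) => n; rewrite geq_max => /andP[n0 Mn].
    split; first by rewrite ler1n.
    split=> //; apply: ltW; apply: (lt_le_trans (truncnS_gt M)); rewrite ler_nat.
    exact: Mn.
  exists C; split => // delta d01; have [N HN] := H delta d01.
  exists N => n nN dO O Pr Z ZP.
  have [] := HN n nN dO O Pr Z ZP.
  have -> : beta^-1 / 2 = (2 * beta)^-1 by rewrite invfM mulrC.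
  have -> : 1 - beta^-1 * (beta / (s * beta + 1)) = s * beta / (s * beta + 1).
    by field; rewrite !gt_eqF.
  by [].
(* Here g = alpha - s, so that [a < s + g] reads a < alpha. The case assumption makes g exceed
   1/beta and s stay below alpha, whence [kp * s <= 1] for kp = 1/alpha. *)
- have [a [/andP[ba a_le1] Ma] a_lt] := index_lt _ a0a.
  have a01 : 0 <= a <= 1 by rewrite a_le1 andbT (le_trans _ ba)// invr_ge0 ltW.
  have alpha_gt : s + beta^-1 < alpha by exact: le_lt_trans sa a0a.
  have b0 : 0 < beta^-1 by rewrite invr_gt0.
  have al0 : 0 < alpha by lra.
  have g0 : 0 < alpha - s by lra.
  have bg : beta^-1 <= alpha - s by lra.
  have asg : a < s + (alpha - s) by lra.
  have kp0 : 0 < alpha^-1 by rewrite invr_gt0.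
  have kps : alpha^-1 * s <= 1 by rewrite mulrC ler_pdivrMr// mul1r; lra.
  have [|C [C0 H]] := rate a (alpha - s) alpha^-1 c1 c2
      (fun n => n%:R / ln n%:R `^ r) nu 2 a01 Ma g0 bg asg kp0 kps c10 c20 nuB.
    by move=> M; exact: log_ratio_unbounded.
  exists C; split => // delta d01; have [N HN] := H delta d01.
  exists N => n nN dO O Pr Z ZP.
  have [] := HN n nN dO O Pr Z ZP.
  have -> : 1 - (alpha - s) * alpha^-1 = s / alpha by field; rewrite gt_eqF.
  by [].
Qed.
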